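(* Let $X$ be a random vector in $\mathbb R^p$ and let $X_1,\dots,X_N$ be $N$ i.i.d. copies of $X$. Let $\Gamma=\mathbb E XX^\top$ and $\ell^*=\sqrt{\mathbb E\|X\|_2^2}=\sqrt{\mathrm{Tr}(\Gamma)}$. Assume that $X$ is centered, symmetric, and satisfies: (H1) $\mathbb P\Big\{\max_{1\le i\le N}\Big|\frac{\|X_i\|_2^2}{(\ell^* )^2}-1\Big|\le\delta\Big\}\ge1-\gamma$ for some constants $\delta<1/2$ and $\gamma<1$; (H2) for every $v\in\mathbb R^p$ and every $2\le q\le R\log(eN)$, $\|\langle X,v\rangle\|_{L_q}\le Lq^{1/\alpha}\|\langle X,v\rangle\|_{L_2}$, for some constants $R,L,\alpha$. Let $A=[X_1|\cdots|X_N]:\mathbb R^N\to\mathbb R^p$ be the $p\times N$ random matrix with columns $X_1,\dots,X_N$. Then there are constants $\kappa_{DM}$ and $c_0$ depending only on $L$ and $\alpha$ such that, when $N\le\kappa_{DM}\,d_*(\Gamma^{-1/2}B_2^p)$, with probability at least $1-\gamma-N^{-c_0}$, for all $\lambda\in\mathbb R^N$, $$(1-2\delta)\,\ell^*\|\lambda\|_2\le\|A\lambda\|_2\le(1+2\delta)\,\ell^*\|\lambda\|_2.$$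
   Context: $d_*(\Gamma^{-1/2}B_2^p)=(\mathbb E\|\Gamma^{1/2}g\|_2)^2/\|\Gamma\|_{op}$, with $g\sim\mathcal N(0,I_p)$, is the Dvoretzky dimension of the ellipsoid $\Gamma^{-1/2}B_2^p=\{v:\|\Gamma^{1/2}v\|_2\le1\}$. For a real random variable $W$, $\|W\|_{L_q}=(\mathbb E|W|^q)^{1/q}$. A random vector is symmetric if it has the same distribution as its opposite.
   Formalization: κ_DM is allowed to depend on δ and R as well as on L and α, and δ>0, R>0 are assumed; with κ_DM depending only on L and α the claim fails (e.g. X uniform on a sphere, δ=0, N=2). c_0 depends only on L and α. *)

(* Defs.v *)
From HB Require Import structures.
From mathcomp Require Import all_boot all_order all_algebra.
From mathcomp Require Import all_classical all_reals all_analysis.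

Set Implicit Arguments.
Unset Strict Implicit.
Unset Printing Implicit Defensive.

Import Order.TTheory GRing.Theory Num.Theory.
Import numFieldNormedType.Exports.

Local Open Scope classical_set_scope.
Local Open Scope ring_scope.

(* Random vectors of R^p are measurable maps into [p.-tuple R], whose           *)
(* sigma-algebra (generated by the coordinates) is the Borel one; linear       *)
(* algebra is done on the associated column vectors.                           *)

Definition vec (R : realType) (p : nat) (x : p.-tuple R) : 'cV[R]_p :=
  \col_i tnth x i.

Definition dotp (R : realType) (p : nat) (u v : 'cV[R]_p) : R :=
  \sum_i u i 0 * v i 0.

(* The canonical norm on matrices in the library is the sup norm. *)
Definition norm2 (R : realType) (p : nat) (v : 'cV[R]_p) : R :=
  Num.sqrt (\sum_i v i 0 ^+ 2).

Definition opnorm (R : realType) (p : nat) (M : 'M[R]_p) : R :=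
  sup [set norm2 (M *m v) | v in [set v | norm2 v <= 1]].

Definition psd (R : realType) (p : nat) (M : 'M[R]_p) : Prop :=
  M^T = M /\ forall v : 'cV[R]_p, 0 <= dotp (M *m v) v.

(* The positive semidefinite square root, unique when it exists, which is      *)
(* the case exactly when M is positive semidefinite; 0 is a dummy value.       *)
Definition sqrtmx (R : realType) (p : nat) (M : 'M[R]_p) : 'M[R]_p :=
  xget 0 [set S | psd S /\ S *m S = M].

Section RandomVectors.
Context d (T : measurableType d) (R : realType) (P : probability T R).
Implicit Types p N : nat.

Definition coordinate p (X : T -> p.-tuple R) (i : 'I_p) : T -> R :=
  fun w => tnth (X w) i.

Definition marginal p (X : T -> p.-tuple R) (v : 'cV[R]_p) : T -> R :=
  fun w => dotp (vec (X w)) v.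

Definition square_integrable p (X : T -> p.-tuple R) : Prop :=
  forall i, coordinate X i \in Lfun P 2%:E.

Definition centered p (X : T -> p.-tuple R) : Prop :=
  forall i, ('E_P[coordinate X i] = 0)%E.

(* Measures are functions on arbitrary sets, hence laws are only compared on   *)
(* measurable ones, here and below.                                            *)
Definition symmetric_rv p (X : T -> p.-tuple R) : Prop :=
  forall B : set (p.-tuple R), measurable B ->
    P (X @^-1` B) = P ((fun w => [tuple - tnth (X w) i | i < p]) @^-1` B).

Definition second_moment_mx p (X : T -> p.-tuple R) : 'M[R]_p :=
  \matrix_(i, j) fine ('E_P[fun w => (coordinate X i w * coordinate X j w)%R])%E.

Definition lstar p (X : T -> p.-tuple R) : R :=
  Num.sqrt (fine ('E_P[fun w => (norm2 (vec (X w)) ^+ 2)%R])%E).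

(* Subfamilies are covered by taking some of the B i to be the whole space. *)
Definition independent_rvs p N (Xs : 'I_N -> T -> p.-tuple R) : Prop :=
  forall B : 'I_N -> set (p.-tuple R), (forall i, measurable (B i)) ->
    P [set w | forall i, B i (Xs i w)] = (\prod_(i < N) P (Xs i @^-1` B i))%E.

Definition iid_copies d0 (T0 : measurableType d0) (P0 : probability T0 R) p
    (X : T0 -> p.-tuple R) N (Xs : 'I_N -> T -> p.-tuple R) : Prop :=
  independent_rvs Xs /\
  forall (i : 'I_N) (B : set (p.-tuple R)), measurable B ->
    P (Xs i @^-1` B) = P0 (X @^-1` B).

(* g ~ N(0, I_p): the coordinates of g are i.i.d. standard normal variables. *)
Definition standard_gaussian p (g : T -> p.-tuple R) : Prop :=
  forall B : 'I_p -> set R, (forall i, measurable (B i)) ->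
    P [set w | forall i, B i (coordinate g i w)] =
    (\prod_(i < p) normal_prob 0 1 (B i))%E.

(* The Dvoretzky dimension of {v : |G^(1/2) v|_2 <= 1}, for G positive         *)
(* semidefinite and g ~ N(0, I_p).                                             *)
Definition dvoretzky_dim p (g : T -> p.-tuple R) (G : 'M[R]_p) : R :=
  fine ('E_P[fun w => norm2 (sqrtmx G *m vec (g w))])%E ^+ 2 / opnorm G.

Definition random_matrix p N (Xs : 'I_N -> T -> p.-tuple R) (w : T) :
    'M[R]_(p, N) :=
  \matrix_(i, j) coordinate (Xs j) i w.

End RandomVectors.

Section Assumptions.
Context (R : realType) (p N : nat).

Definition norm_concentration d0 (T0 : measurableType d0)
    (P0 : probability T0 R) (X : T0 -> p.-tuple R)
    d (T : measurableType d) (P : probability T R)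
    (Xs : 'I_N -> T -> p.-tuple R) (delta gamma : R) : Prop :=
  ((1 - gamma)%:E <=
   P [set w | (\big[Num.max/0]_(i < N)
      `|norm2 (vec (Xs i w)) ^+ 2 / lstar P0 X ^+ 2 - 1| <= delta)%R])%E.

Definition moment_growth d0 (T0 : measurableType d0)
    (P0 : probability T0 R) (X : T0 -> p.-tuple R) (Rq L alpha : R) : Prop :=
  forall (v : 'cV[R]_p) (q : R),
    2 <= q -> q <= Rq * ln (expR 1 * N%:R) ->
    ('N[P0]_(q%:E)[EFin \o marginal X v] <=
     (L * q `^ alpha^-1)%:E * 'N[P0]_(2%:E)[EFin \o marginal X v])%E.

End Assumptions.
Arguments moment_growth {R p} N {d0 T0} P0 X Rq L alpha.

(* Main.v *)
(* Write [sigma^2 = |Gamma|_op]. As [(E|Gamma^(1/2) g|)^2 <= c Tr Gamma], the hypothesis  *)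
(* on [N] says that [N sigma^2 <= kappa ell^2] with [kappa] small. On the event of (H1)    *)
(* it suffices to bound the off-diagonal part [H] of the Gram matrix of the [X_i] by       *)
(* [delta/2 ell^2]. By multi-affinity one may restrict to the forms [<A u, A v>] where     *)
(* [u] and [v] have disjoint supports and entries [+-2^-s]. There are few such vectors,    *)
(* and a union bound over prefixes [v] and sets [K] disjoint from their supports, with     *)
(* [#|supp v| <= D #|K|], shows that with probability [1 - 1/N] some [i] in [K] has        *)
(* [|<X_i, A v>| <= C (N/#|K|)^(1/4) sigma |A v|]: this needs only one moment, of order    *)
(* [q ~ 8 D] depending on [delta], which (H2) provides once [N >= exp (q/R)] (smaller [N]  *)
(* are handled by second moments of the entries of [H]). Thus at every scale few indices   *)
(* are bad: the good ones contribute [O(sigma |A| sqrt N)], and the bad ones, peeled off   *)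
(* scale by scale, at most [|A|^2 / sqrt D]. Since [|A|^2 <= 3/2 ell^2 + |H|], this        *)
(* inequality bounds [|H|] by itself.                                                       *)

Require Import Defs.
From HB Require Import structures.
From mathcomp Require Import all_boot all_order all_algebra.
From mathcomp Require Import all_classical all_reals all_analysis.
From mathcomp Require Import measurable_realfun.
From mathcomp Require Import zify ring lra.
Import Order.TTheory GRing.Theory Num.Theory.
Import numFieldNormedType.Exports.
Local Open Scope ring_scope.
Set Implicit Arguments.
Unset Strict Implicit.
Unset Printing Implicit Defensive.

(** * Peeling off bad indices scale by scale *)

(** On the event of (H1) the diagonal of the Gram matrix is within [delta * ell^2] of [ell^2]. It
    remains to bound the off-diagonal form by [delta/2 * ell^2 * nsq v]; [near_isometry] then passes
    from squared norms to norms.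

    For large [N] the form is bounded in terms of itself. If [|A v|^2 <= B * nsq v] for all [v],
    then [offdiag_form_bound] bounds the form by a multiple of
    [C * sigma * sqrt (B * N * d) + B / d]. As [N * sigma^2 <= kappa * ell^2], taking first [d]
    large and then [kappa] small makes this at most [delta/4 * B], and [offdiag_apriori] absorbs the
    part of [B] that comes from the form.

    The deterministic core is [peeling_bound]. Each row of the form is paired with the prefix of
    larger entries of the vector, revealed scale by scale. Rows whose product with the prefix is
    small are summed directly. The exceptional rows carry a fraction [1/d^2] of the mass of their
    scale, so the crude bound by [B] suffices for them.

    That exceptional rows are few is the content of [large_event]. By independence, [large_together]
    bounds the probability that all rows of a set [K] are exceptional by a [#|K|]-th power. A moment
    of order [8 * d^2 + 8] makes this power beat the number of sets and of prefixes, which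
    [code_count] and [union_bound_sum] estimate. When (H2) does not reach that order, [N] is bounded
    by a constant, and [small_event] with [small_offdiag] bounds the entries one by one. *)

Definition nsq (R : realType) (N : nat) (v : 'I_N -> R) : R := \sum_i v i ^+ 2.

Definition bil (R : realType) (N : nat) (G : 'I_N -> 'I_N -> R) (u v : 'I_N -> R) : R :=
  \sum_i \sum_j u i * G i j * v j.

Definition dyadic (R : realType) (N S : nat) (v : 'I_N -> R) : Prop :=
  forall i, v i = 0 \/ exists2 s, (0 < s <= S)%N & `|v i| = 2^-1 ^+ s.

Definition root4 (R : realType) (x : R) : R := Num.sqrt (Num.sqrt x).

Section Level.
Context (R : realType) (N : nat).
Local Notation h := (2^-1 : R).

Let h_ge0 : 0 <= h. Proof. by rewrite invr_ge0. Qed.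
Let h_le1 : h <= 1. Proof. lra. Qed.
Let double_h : 2 * h = 1. Proof. by rewrite divff. Qed.
Let hn_ge0 n : 0 <= h ^+ n. Proof. exact: exprn_ge0. Qed.
Let hS n : h ^+ n = 2 * h ^+ n.+1. Proof. by rewrite exprS mulrA double_h mul1r. Qed.
Let h_mono m n : (m <= n)%N -> h ^+ n <= h ^+ m. Proof. by move=> mn; apply: ler_wiXn2l. Qed.

(** The products [e t * z t] telescope. Applied with [e] the indicator of a chain of bad scales that
    equals 1 at [n.+1], it splits the last [z] into good values and increments. *)
Lemma abel_sum (e z : nat -> R) (n : nat) : z 0%N = 0 ->
  \sum_(t < n.+1) (e t.+1 - e t) * z t +
  \sum_(t < n) e t.+1 * (z t.+1 - z t) = e n.+1 * z n.
Proof.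
move=> z0; elim: n => [|n IH]; first by rewrite big_ord_recr !big_ord0 /= z0; ring.
rewrite big_ord_recr /= [X in _ + X]big_ord_recr /=.
move: IH; set a := (\sum_(t < n.+1) _); set b := (\sum_(t < n) _) => IH.
have -> : a = e n.+1 * z n - b by rewrite -IH; ring.
ring.
Qed.

Definition ndist (s t : nat) : nat := (s - t) + (t - s).

Lemma sum_half_dist (s n : nat) : \sum_(t < n) h ^+ ndist s t <= 3.
Proof.
(* The sharper bound needed by the induction: up to [s] the partial sums grow geometrically, and
   beyond [s] they keep a geometric distance to 3. *)
have : \sum_(t < n) h ^+ ndist s t <=
    (if (n <= s)%N then h ^+ (s - n) else 3 - 2 * h ^+ (n - s)).
  elim: n => [|n IH]; first by rewrite big_ord0 leq0n.
  rewrite big_ord_recr /= /ndist.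
  have [ns|sn] := ltnP n s.
    move: IH; rewrite (ltnW ns) (eqP (ltnW ns)) addn0 => IH.
    have E : h ^+ (s - n.+1) = 2 * h ^+ (s - n) by rewrite -[in RHS]subnSK// -hS.
    by rewrite E; lra.
  have [ns|ns] := leqP n s.
    have -> : s = n by apply/eqP; rewrite eqn_leq ns sn.
    move: IH; rewrite ns; have -> : s = n by apply/eqP; rewrite eqn_leq ns sn.
    by rewrite subnn subSnn expr0 expr1; lra.
  move: IH; rewrite leqNgt ns /= => IH.
  rewrite (eqP sn) add0n subSn// (hS (n - s)).
  move: IH; rewrite (hS (n - s)); lra.
move/le_trans; apply.
case: ifP => _; last by have := hn_ge0 (n - s); lra.
by have := h_mono (leq0n (s - n)); rewrite expr0; lra.
Qed.

Context (S : nat) (lam : 'I_N -> R) (s : 'I_N -> nat).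
Hypothesis lamE : forall i, `|lam i| = h ^+ s i.
Hypothesis lam_le : nsq lam <= 2.

(* The weights make the sizes of consecutive levels comparable ([lev_size_step]), while *)
(* the masses still have a bounded sum; the plain counts only satisfy the latter.     *)
Definition lev_mass (t : nat) : R := \sum_i lam i ^+ 2 * h ^+ ndist (s i) t.
Definition lev_size (t : nat) : R := 4 ^+ t * lev_mass t.

Let lam2 i : lam i ^+ 2 = h ^+ (2 * s i).
Proof. by rewrite -real_normK ?num_real// lamE -exprM mulnC. Qed.

Let four_h t : 4 ^+ t * h ^+ (2 * t) = 1 :> R.
Proof.
rewrite exprM -exprMn (_ : 4 * h ^+ 2 = 1) ?expr1n//.
by rewrite (_ : 4 = 2 ^+ 2) -?exprMn ?double_h ?expr1n// expr2; ring.
Qed.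

Lemma lev_mass_ge0 t : 0 <= lev_mass t.
Proof. by apply: sumr_ge0 => i _; rewrite mulr_ge0 ?sqr_ge0. Qed.

Lemma lev_size_ge0 t : 0 <= lev_size t.
Proof. by rewrite mulr_ge0 ?lev_mass_ge0 ?exprn_ge0. Qed.

Lemma lev_massE t : lev_mass t = lev_size t * h ^+ (2 * t).
Proof. by rewrite /lev_size mulrAC four_h mul1r. Qed.

Lemma lev_mass_sum n : \sum_(t < n) lev_mass t <= 6.
Proof.
rewrite exchange_big /=.
apply: (@le_trans _ _ (\sum_i lam i ^+ 2 * 3)).
  by apply: ler_sum => i _; rewrite -mulr_sumr ler_wpM2l ?sqr_ge0 ?sum_half_dist.
rewrite -mulr_suml; move: lam_le; rewrite /nsq; lra.
Qed.

Lemma lev_size_le t : lev_size t <= 2 * 4 ^+ t.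
Proof.
rewrite /lev_size mulrC ler_wpM2r ?exprn_ge0//; apply: le_trans lam_le.
apply: ler_sum => i _; rewrite ler_piMr ?sqr_ge0//.
by rewrite exprn_ile1.
Qed.

(** Moving the reference scale by one changes each distance by at most one, which costs a factor 2
    in the mass; the normalization [4 ^ t] brings the other 4. *)
Lemma lev_size_step t : lev_size t.+1 <= 8 * lev_size t.
Proof.
clear lam2 lamE lam_le.
have H : lev_mass t.+1 <= 2 * lev_mass t.
  rewrite mulr_sumr; apply: ler_sum => i _; rewrite mulrCA ler_wpM2l ?sqr_ge0//.
  rewrite (hS (ndist (s i) t.+1)) ler_wpM2l//.
  apply: h_mono; rewrite /ndist.
  by case: (leqP (s i) t) => H; lia.
rewrite /lev_size exprS; have := lev_mass_ge0 t => b0.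
have := exprn_ge0 t (ler0n R 4) => p0.
have := ler_wpM2l p0 H; lra.
Qed.

(** An index with [s i <= t] weighs [4^t * 4^-(s i) * 2^-(t - s i)], that is [2^(t - s i) >= 1], in
    [lev_size t]. *)
Lemma lev_size_card t : #|[set i | (s i <= t)%N]|%:R <= lev_size t.
Proof.
rewrite -sum1_card natr_sum big_mkcond /= /lev_size mulr_sumr.
apply: ler_sum => i _; rewrite inE; case: ifP => st; last first.
  by rewrite mulr_ge0 ?exprn_ge0// mulr_ge0 ?sqr_ge0.
rewrite lam2 /ndist (eqP st) add0n mulrA.
have -> : 4 ^+ t * h ^+ (2 * s i) = 4 ^+ (t - s i) :> R.
  by rewrite -{1}(subnK st) exprD -mulrA four_h mulr1.
rewrite -exprMn exprn_ege1//; lra.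
Qed.

End Level.

Section Peeling.
Context (R : realType) (N S d : nat).
Local Notation h := (2^-1 : R).
Context (G : 'I_N -> 'I_N -> R) (F : ('I_N -> R) -> R) (B M : R) (tau : R -> R).
Hypothesis d_gt0 : (0 < d)%N.
Hypothesis B_ge0 : 0 <= B.
Hypothesis G_le : forall u v,
  `|bil G u v| <= B * (d%:R * nsq u + d%:R^-1 * nsq v).
Hypothesis F_ge0 : forall v, 0 <= F v.
Hypothesis F_le : forall v, nsq v <= 2 -> F v <= M.
Hypothesis tau_ge0 : forall x, 0 <= tau x.
Hypothesis tau_anti : forall x y : R, 0 < x -> x <= y -> tau y <= tau x.
Hypothesis few_large : forall (K : {set 'I_N}) (v : 'I_N -> R),
  K != finset.set0 -> (forall i, i \in K -> v i = 0) -> nsq v <= 2 -> dyadic S v ->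
  (#|[set i | (v i != 0)%R]| <= d ^ 2 * #|K|)%N ->
  exists2 i, i \in K & `|\sum_j G i j * v j| <= tau #|K|%:R * F v.
Context (lam : 'I_N -> R) (s : 'I_N -> nat).
Hypothesis s_le : forall i, (0 < s i <= S)%N.
Hypothesis lamE : forall i, `|lam i| = h ^+ s i.
Hypothesis lam_le : nsq lam <= 2.
Context (I : {set 'I_N}) (W : nat -> {set 'I_N}).
Hypothesis W0 : W 0%N = finset.set0.
Hypothesis W_mono : forall t, W t \subset W t.+1.
Hypothesis W_le : forall t, W t \subset [set j | (s j <= t)%N].
Hypothesis WI : forall t i, i \in I -> i \notin W t.

Let N_gt0 : I != finset.set0 -> forall t, 0 < lev_size lam s t.
Proof.
move=> /set0Pn[i _] t; rewrite mulr_gt0 ?exprn_gt0//.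
rewrite /lev_mass (bigD1 i)//= ltr_pwDl//; last first.
  by apply: sumr_ge0 => j _; rewrite mulr_ge0 ?sqr_ge0 ?exprn_ge0 ?invr_ge0.
rewrite -real_normK ?num_real// lamE mulr_gt0//.
Qed.

Let pre (t : nat) (j : 'I_N) : R := if j \in W t then lam j else 0.
Let z (t : nat) (i : 'I_N) : R := \sum_j G i j * pre t j.
Let thr (t : nat) : R := tau (lev_size lam s t / d%:R ^+ 2).
(** The threshold is what [few_large] guarantees for sets of [lev_size / d^2] rows, so no larger set
    can consist of bad rows. *)
Let bad (t : nat) (i : 'I_N) : bool := thr t * F (pre t) < `|z t i|.

Let pre_nsq t : nsq (pre t) <= 2.
Proof.
apply: le_trans lam_le; apply: ler_sum => i _; rewrite /pre.
by case: ifP => // _; rewrite expr0n sqr_ge0.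
Qed.

Let d2_gt0 : 0 < d%:R ^+ 2 :> R. Proof. by rewrite exprn_gt0// ltr0n. Qed.

(** If the bad set were larger, the support of the prefix, of size at most [lev_size], would be
    below [d^2] times its cardinal. Then [few_large] would produce a row in it that is not bad,
    since [tau] is antitone. *)
Let bad_card t : #|[set i in I | bad t i]|%:R <= lev_size lam s t / d%:R ^+ 2.
Proof.
rewrite leNgt; apply/negP => big.
set K := [set i in I | bad t i] in big *.
have K0 : K != finset.set0.
  apply: contraTN big => /eqP->; rewrite cards0 -leNgt.
  by rewrite divr_ge0 ?lev_size_ge0// ltW.
have I0 : I != finset.set0.
  by case/set0Pn: K0 => i; rewrite inE => /andP[iI _]; apply/set0Pn; exists i.
have Kv i : i \in K -> pre t i = 0.
  by rewrite inE => /andP[iI _]; rewrite /pre (negbTE (WI t iI)).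
have dy : dyadic S (pre t).
  move=> i; rewrite /pre; case: ifP => _; last by left.
  by right; exists (s i).
have cK : (#|[set i | (pre t i != 0)%R]| <= d ^ 2 * #|K|)%N.
  rewrite -(ler_nat R) natrM natrX.
  have /ltW := big; rewrite ler_pdivrMr// mulrC; apply: le_trans.
  apply: le_trans (lev_size_card lamE t); rewrite ler_nat.
  apply: subset_leq_card; apply/fintype.subsetP => i; rewrite inE /pre.
  by case: ifP => [/(fintype.subsetP (W_le t))//|]; rewrite eqxx.
have [i iK le1] := few_large K0 Kv (pre_nsq t) dy cK.
have : bad t i by move: iK; rewrite inE => /andP[].
rewrite /bad ltNge => /negP nb; apply: nb; apply: le_trans le1 _.
rewrite ler_wpM2r//; apply: tau_anti; last exact: ltW.
by rewrite divr_gt0// N_gt0.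
Qed.

(* [chain i t] marks the scales [t] from which [i] stays bad up to its own scale; the  *)
(* summation by parts along it leaves good terms and increments of few bad indices.   *)
Let chain (i : 'I_N) (t : nat) : bool := all (fun t => bad t i) (index_iota t (s i).+1).

Let chainS i t : (t <= s i)%N -> chain i t = bad t i && chain i t.+1.
Proof. by move=> ts; rewrite /chain /index_iota subSn// subSS. Qed.

Let chain_top i : chain i (s i).+1. Proof. by rewrite /chain /index_iota subnn. Qed.

Let z0 i : z 0%N i = 0.
Proof. by rewrite /z big1// => j _; rewrite /pre W0 inE mulr0. Qed.

(** The difference of indicators is nonzero only when the chain starts exactly at [t.+1]. Then [t]
    is not bad and [z t i] is below the threshold. *)
Let good_term i t : (t <= s i)%N ->
  `|lam i * (((chain i t.+1)%:R - (chain i t)%:R) * z t i)| <=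
  thr t * M * (`|lam i| * (chain i t.+1)%:R).
Proof.
move=> ts; rewrite (chainS ts).
have zM : ~~ bad t i -> `|z t i| <= thr t * M.
  rewrite -leNgt => /le_trans; apply; apply: ler_wpM2l; [exact: tau_ge0|exact: F_le (pre_nsq t)].
case: (boolP (chain i t.+1)); case: (boolP (bad t i)) => nb _ /=.
- rewrite subrr mul0r mulr0 normr0; rewrite mulr_ge0 ?mulr_ge0 ?tau_ge0//.
  exact: le_trans (F_ge0 _) (F_le (pre_nsq t)).
- rewrite subr0 mul1r mulr1 normrM mulrC; apply: ler_wpM2r => //; exact: zM.
- by rewrite subrr mul0r mulr0 normr0 !mulr0.
- by rewrite subrr mul0r mulr0 normr0 !mulr0.
Qed.

(** Indices of scale exactly [t] contribute at most [h^t * lev_size t]. Those of a later scale are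
    bad at [t.+1], so they number at most [8 * lev_size t] and have entries at most [h^(t+1)]; in
    all [1 + 8/2 = 5]. *)
Let chain_sum t : \sum_(i in I | (t <= s i)%N) `|lam i| * (chain i t.+1)%:R <=
  5 * (h ^+ t * lev_size lam s t).
Proof.
have h1 : h <= 1 by lra.
have h0 : 0 <= h by lra.
apply: (@le_trans _ _ (h ^+ t * #|[set i | (s i <= t)%N]|%:R +
    h ^+ t.+1 * #|[set i in I | bad t.+1 i]|%:R)).
  rewrite -!sum1_card !natr_sum !mulr_sumr.
  apply: (@le_trans _ _ (\sum_i ((if (s i <= t)%N then h ^+ t else 0) +
      (if (i \in I) && bad t.+1 i then h ^+ t.+1 else 0)))); last first.
    rewrite big_split /= -!big_mkcond /= lerD// le_eqVlt; apply/orP; left; apply/eqP.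
      by apply: eq_big => [i|i _]; rewrite ?inE ?mulr1.
    by apply: eq_big => [i|i _]; rewrite ?inE ?mulr1.
  rewrite big_mkcond /=; apply: ler_sum => i _.
  have p1 := exprn_ge0 t h0; have p2 := exprn_ge0 t.+1 h0.
  case: (boolP (i \in I)) => iI /=; last by case: ifP => _; rewrite addr0.
  have [ts|st|->] := ltngtP t (s i) => /=.
  + rewrite (chainS ts) add0r; case: (bad t.+1 i) => /=; last by rewrite mulr0.
    rewrite lamE; apply: (@le_trans _ _ (h ^+ s i)); last by rewrite ler_wiXn2l.
    by rewrite ler_piMr ?exprn_ge0//; case: (chain _ _).
  + by case: ifP => _; rewrite ?addr0// addr_ge0.
  + by rewrite lamE chain_top mulr1 lerDl; case: ifP.
have A1 := lev_size_card lamE t.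
have A2 := bad_card t.+1.
have A3 := lev_size_step lam s t.
have m0 := lev_size_ge0 lam s t.
have A4 : #|[set i in I | bad t.+1 i]|%:R <= 8 * lev_size lam s t.
  apply: le_trans A2 _; apply: le_trans A3.
  rewrite ler_pdivrMr// ler_peMr ?lev_size_ge0// -natrX ler1n.
  by rewrite expn_gt0 d_gt0.
have p1 := exprn_ge0 t h0; have p2 := exprn_ge0 t.+1 h0.
have := ler_wpM2l p1 A1; have := ler_wpM2l p2 A4; rewrite exprS; lra.
Qed.

(** [peel t] and [incr t] are the arguments of the form that collects, over all rows, the increments
    from scale [t] to [t.+1] in the summation by parts. *)
Let peel (t : nat) (i : 'I_N) : R :=
  if [&& i \in I, (t < s i)%N & chain i t.+1] then lam i else 0.
Let incr (t : nat) (j : 'I_N) : R := pre t.+1 j - pre t j.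

Let peel_nsq t : nsq (peel t) <= lev_mass lam s t.+1 / d%:R ^+ 2.
Proof.
rewrite (lev_massE lam s) mulrAC.
have h0 : 0 <= h by lra.
apply: le_trans (ler_wpM2r _ (bad_card t.+1)); last by rewrite exprn_ge0.
rewrite -sum1_card natr_sum mulr_suml [leRHS]big_mkcond /=.
apply: ler_sum => i _; rewrite /peel inE mul1r.
case: ifP => [/and3P[iI ts]|_]; last by rewrite expr0n /=; case: ifP; rewrite ?exprn_ge0.
rewrite (chainS ts) iI => /andP[-> _] /=.
rewrite -real_normK ?num_real// lamE -exprM mulnC; apply: ler_wiXn2l => //; first by lra.
by rewrite leq_mul2l.
Qed.

(** Since the sets [W t] increase, the increments have disjoint supports and their squared norms add
    up. *)
Let incr_nsq n : \sum_(t < n) nsq (incr t) <= 2.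
Proof.
apply: (@le_trans _ _ (nsq (pre n))); last exact: pre_nsq.
rewrite le_eqVlt; apply/orP; left; apply/eqP.
elim: n => [|n IH].
  rewrite big_ord0 /nsq big1// => i _; by rewrite /pre W0 inE expr0n.
rewrite big_ord_recr /= IH -big_split /=; apply: eq_bigr => i _.
rewrite /incr /pre; case: (boolP (i \in W n)) => [/(fintype.subsetP (W_mono n))->|_].
  by rewrite subrr expr0n addr0.
by rewrite subr0 expr0n add0r.
Qed.

(** The row [i] equals [lam i * z (s i) i], to which [abel_sum] is applied along [chain i]. The good
    terms give the first sum by [good_term] and [chain_sum]. The increments of bad rows are bounded
    by [G_le], which only sees the small vectors [peel t]. *)
Lemma peeling_bound :
  `|\sum_(i in I) \sum_(j in W (s i)) lam i * G i j * lam j| <=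
  5 * M * \sum_(t < S.+1) h ^+ t * lev_size lam s t * tau (lev_size lam s t / d%:R ^+ 2)
  + 8 * B / d%:R.
Proof.
have -> : \sum_(i in I) \sum_(j in W (s i)) lam i * G i j * lam j =
  \sum_(i in I) \sum_(t < S.+1 | (t <= s i)%N)
     lam i * (((chain i t.+1)%:R - (chain i t)%:R) * z t i) +
  \sum_(t < S) bil G (peel t) (incr t).
  have -> : \sum_(t < S) bil G (peel t) (incr t) =
    \sum_(i in I) \sum_(t < S | (t < s i)%N)
        lam i * ((chain i t.+1)%:R * (z t.+1 i - z t i)).
    transitivity (\sum_i \sum_(t < S) (if (i \in I) && (t < s i)%N then
        lam i * ((chain i t.+1)%:R * (z t.+1 i - z t i)) else 0)); last first.
      rewrite [RHS]big_mkcond /=; apply: eq_bigr => i _.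
      by case: (i \in I) => /=; [rewrite -big_mkcond|rewrite big1].
    rewrite [RHS]exchange_big /=; apply: eq_bigr => t _; apply: eq_bigr => i _.
    rewrite /peel /z; case: (boolP (i \in I)) => iI /=; last first.
      by apply: big1 => j _; rewrite !mul0r.
    case: (boolP (t < s i)%N) => ts /=; last first.
      by apply: big1 => j _; rewrite !mul0r.
    case: (chain i t.+1) => /=; last first.
      by rewrite mul0r mulr0; apply: big1 => j _; rewrite !mul0r.
    rewrite mul1r -sumrB mulr_sumr; apply: eq_bigr => j _; rewrite /incr; ring.
  rewrite -big_split /=; apply: eq_bigr => i iI.
  have /andP[_ sS] := s_le i.
  have := @abel_sum R (fun t => (chain i t)%:R) (fun t => z t i) (s i) (z0 i).
  rewrite chain_top mul1r => zE.
  have -> : \sum_(j in W (s i)) lam i * G i j * lam j = lam i * z (s i) i.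
    rewrite /z mulr_sumr big_mkcond /=; apply: eq_bigr => j _; rewrite /pre.
    by case: ifP => _; ring.
  rewrite -!mulr_sumr -mulrDr -zE; congr (_ * (_ + _)).
    by rewrite (big_ord_widen_cond S.+1 xpredT
         (fun t => ((chain i t.+1)%:R - (chain i t)%:R) * z t i)) ?ltnS.
  by rewrite (big_ord_widen_cond S xpredT
       (fun t => (chain i t.+1)%:R * (z t.+1 i - z t i))).
apply: le_trans (ler_normD _ _) _; apply: lerD.
  apply: le_trans (ler_norm_sum _ _ _) _.
  apply: (@le_trans _ _ (\sum_(i in I) \sum_(t < S.+1 | (t <= s i)%N)
      thr t * M * (`|lam i| * (chain i t.+1)%:R))).
    apply: ler_sum => i _; apply: le_trans (ler_norm_sum _ _ _) _.
    by apply: ler_sum => t ts; exact: good_term.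
  rewrite (exchange_big_dep xpredT)//= mulr_sumr; apply: ler_sum => t _.
  rewrite -mulr_sumr.
  have M0 : 0 <= thr t * M.
    by apply: mulr_ge0; [exact: tau_ge0|exact: le_trans (F_ge0 _) (F_le (pre_nsq t))].
  apply: le_trans (ler_wpM2l M0 (chain_sum t)) _.
  by rewrite le_eqVlt /thr; apply/orP; left; apply/eqP; ring.
apply: le_trans (ler_norm_sum _ _ _) _.
(* The weights [d] and [1/d] are balanced: the masses sum to at most 6 and the increments to at most
   2, which gives [d * 6 / d^2 + 2 / d = 8 / d]. *)
apply: (@le_trans _ _ (\sum_(t < S)
    B * (d%:R * (lev_mass lam s t.+1 / d%:R ^+ 2) + d%:R^-1 * nsq (incr t)))).
  apply: ler_sum => t _; apply: le_trans (G_le _ _) _.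
  rewrite ler_wpM2l// lerD2r ler_wpM2l ?ler0n//; exact: peel_nsq.
have dg : 0 < d%:R :> R by rewrite ltr0n.
rewrite -mulr_sumr big_split /= -!mulr_sumr -mulr_suml.
have m6 := @lev_mass_sum R N lam s lam_le S.+1.
rewrite big_ord_recl in m6.
have m0 := lev_mass_ge0 lam s 0.
have {m6 m0} m6 : \sum_(t < S) lev_mass lam s t.+1 <= 6 by move: m6 m0 => /=; lra.
have i2 := incr_nsq S.
rewrite (_ : d%:R * ((\sum_(t < S) lev_mass lam s t.+1) / d%:R ^+ 2) +
    d%:R^-1 * (\sum_(t < S) nsq (incr t)) =
    (\sum_(t < S) lev_mass lam s t.+1 + \sum_(t < S) nsq (incr t)) / d%:R); last first.
  by field; rewrite gt_eqF.
rewrite mulrA ler_wpM2r ?invr_ge0 ?ler0n// mulrC ler_wpM2r//; lra.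
Qed.

End Peeling.

(** * Rounding and decoupling *)

Section Root4.
Context (R : realType).
Implicit Types x y k : R.

Lemma root4_ge0 x : 0 <= root4 x. Proof. exact: sqrtr_ge0. Qed.

Lemma le_root4 x y : x <= y -> root4 x <= root4 y.
Proof. by move=> xy; rewrite ler_wsqrtr// ler_wsqrtr. Qed.

Lemma root4_pow k : 0 <= k -> root4 (k ^+ 4) = k.
Proof.
by move=> k0; rewrite /root4 (_ : 4 = 2 * 2)%N// exprM sqrtr_sqr ger0_norm ?sqr_ge0// sqrtr_sqr ger0_norm.
Qed.

Lemma root4M x y : 0 <= x -> root4 (x * y) = root4 x * root4 y.
Proof. by move=> x0; rewrite /root4 sqrtrM// sqrtrM// sqrtr_ge0. Qed.

Lemma root4_gt0 x : 0 < x -> 0 < root4 x.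
Proof. by move=> x0; rewrite /root4 !sqrtr_gt0. Qed.

Lemma pow_root4 x : 0 <= x -> root4 x ^+ 4 = x.
Proof.
by move=> x0; rewrite /root4 (_ : 4 = 2 * 2)%N// exprM !sqr_sqrtr ?sqrtr_ge0.
Qed.

End Root4.

Section MainSum.
Context (R : realType) (N S d : nat).
Local Notation h := (2^-1 : R).
Context (lam : 'I_N -> R) (s : 'I_N -> nat).
Hypothesis d_gt0 : (0 < d)%N.
Hypothesis lam_le : nsq lam <= 2.
Hypothesis SN : (4 ^ S <= 4 * N)%N.

(** The ratio of consecutive terms is the square root of 2, at least [4/3], so the last term
    dominates up to the factor [1 / (1 - 3/4) = 4]. *)
Lemma geometric_root4 (a : R) (n : nat) : 0 <= a ->
  \sum_(t < n.+1) root4 (a * 4 ^+ t) <= 4 * root4 (a * 4 ^+ n).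
Proof.
move=> a0; elim: n => [|n IH].
  by rewrite big_ord_recr big_ord0 /= add0r; have := root4_ge0 (a * 4 ^+ 0); lra.
rewrite big_ord_recr /=.
have : 4/3 * root4 (a * 4 ^+ n) <= root4 (a * 4 ^+ n.+1).
  have e : 0 <= 4/3 :> R by lra.
  rewrite -{1}(root4_pow e) -root4M ?exprn_ge0//; apply: le_root4.
  have p : 0 <= a * 4 ^+ n by rewrite mulr_ge0 ?exprn_ge0.
  rewrite (exprS 4 n) (mulrCA a) ler_wpM2r//; lra.
move: IH; lra.
Qed.

(** The exponent [1/4] in [root4] leaves the power [3/4] of [lev_size]. With [lev_size t <= 2 * 4^t]
    the terms grow geometrically, and the last scale, where [4^S <= 4 * N], dominates. The final
    constant uses [32 <= 3^4]. *)
Lemma main_sum_le (C : R) : 0 <= C ->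
  \sum_(t < S.+1) h ^+ t * lev_size lam s t *
     (C * root4 (N%:R / (lev_size lam s t / d%:R ^+ 2))) <=
  12 * C * (Num.sqrt N%:R * Num.sqrt d%:R).
Proof.
move=> C0.
have n0 : 0 <= N%:R :> R by [].
have dp : 0 < d%:R :> R by rewrite ltr0n.
pose a : R := 8 * N%:R * d%:R ^+ 2.
have a0 : 0 <= a by rewrite !mulr_ge0 ?sqr_ge0.
apply: (@le_trans _ _ (\sum_(t < S.+1) C * root4 (a * 4 ^+ t))).
  apply: ler_sum => t _; rewrite mulrCA ler_wpM2l//.
  have m0 := lev_size_ge0 lam s t.
  have mle := lev_size_le s lam_le t.
  have hp : 0 <= h ^+ t * lev_size lam s t by rewrite mulr_ge0 ?exprn_ge0 ?invr_ge0.
  rewrite -{1}(root4_pow hp) -root4M ?exprn_ge0//; apply: le_root4.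
  have [->|mn0] := eqVneq (lev_size lam s t) 0.
    by rewrite mulr0 expr0n mul0r mulr_ge0 ?exprn_ge0.
  have -> : (h ^+ t * lev_size lam s t) ^+ 4 * (N%:R / (lev_size lam s t / d%:R ^+ 2)) =
     (h ^+ t) ^+ 4 * lev_size lam s t ^+ 3 * (N%:R * d%:R ^+ 2).
    by field; rewrite mn0 gt_eqF.
  have -> : a * 4 ^+ t = 8 * 4 ^+ t * (N%:R * d%:R ^+ 2) by rewrite /a; ring.
  rewrite ler_wpM2r ?mulr_ge0 ?sqr_ge0//.
  apply: (@le_trans _ _ ((h ^+ t) ^+ 4 * (2 * 4 ^+ t) ^+ 3)).
    by rewrite ler_wpM2l ?exprn_ge0 ?invr_ge0// lerXn2r ?nnegrE// mulr_ge0// exprn_ge0.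
  have e : h ^+ t * 2 ^+ t = 1 by rewrite -exprMn mulVf ?expr1n// pnatr_eq0.
  have -> : 4 ^+ t = (2 ^+ t) ^+ 2 :> R by rewrite -exprM mulnC exprM; congr (_ ^+ t); ring.
  rewrite (_ : (h ^+ t) ^+ 4 * _ = 8 * ((h ^+ t * 2 ^+ t) ^+ 4 * (2 ^+ t) ^+ 2)); last by ring.
  by rewrite e expr1n mul1r.
rewrite -mulr_sumr (mulrC 12) -mulrA ler_wpM2l//.
apply: le_trans (geometric_root4 _ a0) _.
have q0 : 0 <= 3 * (Num.sqrt N%:R * Num.sqrt d%:R) :> R.
  by rewrite !mulr_ge0 ?sqrtr_ge0.
rewrite (_ : 12 * _ = 4 * (3 * (Num.sqrt N%:R * Num.sqrt d%:R))); last by ring.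
rewrite ler_wpM2l// -[X in _ <= X](root4_pow q0); apply: le_root4.
rewrite !exprMn (_ : 4 = 2 * 2)%N// (exprM (Num.sqrt N%:R)) (exprM (Num.sqrt d%:R)) !sqr_sqrtr ?ler0n//.
have SN' : 4 ^+ S <= 4 * N%:R :> R by rewrite -natrX -natrM ler_nat.
apply: (@le_trans _ _ (a * (4 * N%:R))); first by rewrite ler_wpM2l.
rewrite /a; have : 0 <= N%:R ^+ 2 * d%:R ^+ 2 :> R by rewrite mulr_ge0 ?sqr_ge0.
move=> H; have -> : 8 * N%:R * d%:R ^+ 2 * (4 * N%:R) = 32 * (N%:R ^+ 2 * d%:R ^+ 2) :> R by ring.
rewrite ler_wpM2r// exprM; lra.
Qed.

End MainSum.

Section BoxVertex.
Context (R : realType) (N : nat).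

Definition upd (x : 'I_N -> R) (i : 'I_N) (t : R) : 'I_N -> R :=
  fun j => if j == i then t else x j.

Definition multiaffine (f : ('I_N -> R) -> R) : Prop :=
  forall i x, exists a b, forall t, f (upd x i t) = a + b * t.

Lemma multiaffine_opp f : multiaffine f -> multiaffine (fun x => - f x).
Proof.
move=> fm i x; have [a [b E]] := fm i x.
by exists (- a), (- b) => t; rewrite E; ring.
Qed.

(** An affine function of one variable does not decrease towards one of the two ends, so the
    coordinates can be moved to an end one after the other. *)
Lemma box_vertex f (lo hi : 'I_N -> R) (x : 'I_N -> R) :
  multiaffine f -> (forall i, lo i <= x i <= hi i) ->
  exists2 y, (forall i, y i = lo i \/ y i = hi i) & f x <= f y.
Proof.
move=> fm xb.
suff [y [y1 [_ y3]]] : exists y, (forall i, i \in enum 'I_N -> y i = lo i \/ y i = hi i) /\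
    (forall i, lo i <= y i <= hi i) /\ f x <= f y.
  by exists y => // i; apply: y1; rewrite mem_enum.
elim: (enum 'I_N) => [|i l [y [y1 [y2 y3]]]]; first by exists x.
have [a [b E]] := fm i y.
have yE : upd y i (y i) = y.
  by apply: funext => j; rewrite /upd; case: eqP => // ->.
have /andP[loy yhi] := y2 i.
have step (t : R) : t = lo i \/ t = hi i -> b * y i <= b * t ->
   exists y, (forall k, k \in i :: l -> y k = lo k \/ y k = hi k) /\
    (forall k, lo k <= y k <= hi k) /\ f x <= f y.
  move=> tE bt; exists (upd y i t); split=> [k|]; last split.
  - by rewrite inE /upd; case: eqP => [->|_ /=]; [|exact: y1].
  - move=> k; rewrite /upd; case: eqP => [->|_] //.
    by case: tE => ->; rewrite lexx ?andbT; exact: le_trans yhi.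
  - by apply: le_trans y3 _; rewrite -{1}yE !E lerD2l.
have [b0|b0] := leP 0 b.
  by apply: (step (hi i)); [right|exact: ler_wpM2l].
by apply: (step (lo i)); [left|rewrite ler_nM2l].
Qed.

Lemma box_vertex_norm f (lo hi : 'I_N -> R) (x : 'I_N -> R) :
  multiaffine f -> (forall i, lo i <= x i <= hi i) ->
  exists2 y, (forall i, y i = lo i \/ y i = hi i) & `|f x| <= `|f y|.
Proof.
move=> fm xb; have [f0|f0] := leP 0 (f x).
  have [y y1 y2] := box_vertex fm xb; exists y => //.
  by rewrite ger0_norm// (le_trans y2)// ler_norm.
have [y y1 y2] := box_vertex (multiaffine_opp fm) xb; exists y => //.
by rewrite ltr0_norm// (le_trans y2)// -normrN ler_norm.
Qed.

(** A zero diagonal excludes squares of a coordinate. The two affine factors cover both uses: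
    [x i * (1 - x j)] for decoupling and [v i * v j] for rounding. *)
Lemma multiaffine_form (c : 'I_N -> 'I_N -> R) (p0 p1 q0 q1 : R) :
  (forall i, c i i = 0) ->
  multiaffine (fun x => \sum_i \sum_j (p0 + p1 * x i) * c i j * (q0 + q1 * x j)).
Proof.
move=> c0 i x.
pose A := \sum_(l | l != i) c i l * (q0 + q1 * x l).
pose B := \sum_(k | k != i) (p0 + p1 * x k) * c k i.
pose C := \sum_(k | k != i) \sum_(l | l != i) (p0 + p1 * x k) * c k l * (q0 + q1 * x l).
exists (p0 * A + q0 * B + C), (p1 * A + q1 * B) => t.
rewrite (bigD1 i)//= (bigD1 i)//= c0 mulr0 mul0r add0r.
have -> : \sum_(j | j != i) (p0 + p1 * upd x i t i) * c i j * (q0 + q1 * upd x i t j) =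
   (p0 + p1 * t) * A.
  rewrite /A mulr_sumr; apply: eq_bigr => j ji.
  by rewrite /upd eqxx (negbTE ji); ring.
have -> : \sum_(k | k != i) \sum_j (p0 + p1 * upd x i t k) * c k j * (q0 + q1 * upd x i t j) =
   (q0 + q1 * t) * B + C.
  rewrite /B /C mulr_sumr -big_split /=; apply: eq_bigr => k ki.
  rewrite (bigD1 i)//= /upd eqxx (negbTE ki); congr (_ + _); first by ring.
  by apply: eq_bigr => j ji; rewrite (negbTE ji).
ring.
Qed.

End BoxVertex.

Section FormBound.
Context (R : realType) (N S d : nat).
Local Notation h := (2^-1 : R).
Context (G : 'I_N -> 'I_N -> R) (F : ('I_N -> R) -> R) (B M C : R).
Hypothesis S_gt0 : (0 < S)%N.
Hypothesis NS : (N <= 4 ^ S)%N.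
Hypothesis SN : (4 ^ S <= 4 * N)%N.
Hypothesis d_gt0 : (0 < d)%N.
Hypothesis B_ge0 : 0 <= B.
Hypothesis C_ge0 : 0 <= C.
Hypothesis G_sym : forall i j, G i j = G j i.
Hypothesis G_diag : forall i, G i i = 0.
Hypothesis G_le : forall u v,
  `|bil G u v| <= B * (d%:R * nsq u + d%:R^-1 * nsq v).
Hypothesis F_ge0 : forall v, 0 <= F v.
Hypothesis F_le : forall v, nsq v <= 2 -> F v <= M.
Hypothesis few_large : forall (K : {set 'I_N}) (v : 'I_N -> R),
  K != finset.set0 -> (forall i, i \in K -> v i = 0) -> nsq v <= 2 -> dyadic S v ->
  (#|[set i | (v i != 0)%R]| <= d ^ 2 * #|K|)%N ->
  exists2 i, i \in K &
    `|\sum_j G i j * v j| <= C * root4 (N%:R / #|K|%:R) * F v.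

Let err : R := 60 * C * M * (Num.sqrt N%:R * Num.sqrt d%:R) + 8 * B / d%:R.

Let M_ge0 : 0 <= M.
Proof.
apply: le_trans (F_ge0 (fun=> 0)) (F_le _).
by rewrite /nsq big1// => i _; rewrite expr0n.
Qed.

Let half_bound (lam : 'I_N -> R) (s : 'I_N -> nat) (I : {set 'I_N}) (W : nat -> {set 'I_N}) :
  (forall i, (0 < s i <= S)%N) -> (forall i, `|lam i| = h ^+ s i) -> nsq lam <= 2 ->
  W 0%N = finset.set0 -> (forall t, W t \subset W t.+1) ->
  (forall t, W t \subset [set j | (s j <= t)%N]) ->
  (forall t i, i \in I -> i \notin W t) ->
  `|\sum_(i in I) \sum_(j in W (s i)) lam i * G i j * lam j| <= err.
Proof.
move=> s_le lamE lam_le W0 W_mono W_le WI.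
pose tau (x : R) := C * root4 (N%:R / x).
have tau0 x : 0 <= tau x by rewrite mulr_ge0 ?root4_ge0.
have tau_anti (x y : R) : 0 < x -> x <= y -> tau y <= tau x.
  move=> x0 xy; rewrite ler_wpM2l//; apply: le_root4; rewrite ler_wpM2l//.
  by rewrite lef_pV2// posrE (lt_le_trans x0).
apply: le_trans (peeling_bound d_gt0 B_ge0 G_le F_ge0 F_le tau0 tau_anti few_large
  s_le lamE lam_le W0 W_mono W_le WI) _.
rewrite lerD2r.
have := @main_sum_le R N S d lam s d_gt0 lam_le SN C C_ge0.
have m5 : 0 <= 5 * M by rewrite mulr_ge0.
move=> /(ler_wpM2l m5) /le_trans; apply.
by rewrite le_eqVlt; apply/orP; left; apply/eqP; ring.
Qed.

(** The pairs are split according to which entry is larger. Each half is a sum over rows of products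
    with a prefix, the second one after exchanging the two indices by symmetry. *)
Let split_bound (lam : 'I_N -> R) (s : 'I_N -> nat) (I : {set 'I_N}) :
  (forall i, (0 < s i <= S)%N) -> (forall i, `|lam i| = h ^+ s i) -> nsq lam <= 2 ->
  `|\sum_(i in I) \sum_(j in ~: I) lam i * G i j * lam j| <= 2 * err.
Proof.
move=> s_le lamE lam_le.
have -> : \sum_(i in I) \sum_(j in ~: I) lam i * G i j * lam j =
  \sum_(i in I) \sum_(j in [set j | (j \notin I) && (s j <= s i)%N]) lam i * G i j * lam j +
  \sum_(j in ~: I) \sum_(i in [set i | (i \in I) && (s i < s j)%N]) lam j * G j i * lam i.
  rewrite [X in _ = _ + X](exchange_big_dep (fun i => i \in I)) /=; last first.
    by move=> i j _; rewrite inE => /andP[].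
  rewrite -big_split /=; apply: eq_bigr => i iI.
  rewrite (bigID (fun j => (s j <= s i)%N)) /=; congr (_ + _).
    by apply: eq_bigl => j; rewrite !inE.
  apply: eq_big => [j|j _]; first by rewrite !inE iI -ltnNge.
  by rewrite G_sym; ring.
rewrite mulr_natl mulr2n; apply: le_trans (ler_normD _ _) _; apply: lerD.
  apply: (half_bound (W := fun t => [set j | (j \notin I) && (s j <= t)%N])) => //.
  - apply/setP => j; rewrite !inE leqn0; have /andP[/lt0n_neq0] := s_le j.
    by move=> /negbTE->; rewrite andbF.
  - move=> t; apply/fintype.subsetP => j; rewrite !inE => /andP[->/=].
    by move/leq_trans; apply.
  - by move=> t; apply/fintype.subsetP => j; rewrite !inE => /andP[].
  - by move=> t i iI; rewrite inE iI.
(* The inequality is strict here because ties already belong to the first half. *)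
apply: (half_bound (I := ~: I) (W := fun t => [set j | (j \in I) && (s j < t)%N])) => //.
- by apply/setP => j; rewrite !inE ltn0 andbF.
- move=> t; apply/fintype.subsetP => j; rewrite !inE => /andP[->/=].
  by move/leq_trans; apply.
- by move=> t; apply/fintype.subsetP => j; rewrite !inE => /andP[_ /ltnW].
- by move=> t i; rewrite !inE => /negbTE ->.
Qed.

Let halves (t : R) : 0 <= t -> t <= 2^-1 -> exists2 n,
  (0 < n <= S)%N & t <= h ^+ n /\ (n = S \/ h ^+ n.+1 <= t).
Proof.
move=> t0 t1; suff H n : (n < S)%N -> exists2 m, (0 < m <= n.+1)%N &
    t <= h ^+ m /\ (m = n.+1 \/ h ^+ m.+1 <= t).
  have [] := H S.-1; first by rewrite prednK.
  by rewrite prednK// => m; exists m.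
elim: n => [|n IH] nS; first by exists 1%N => //; rewrite expr1; split=> //; left.
have [m /andP[m0 mn] [tm [mE|ht]]] := IH (ltnW nS); last first.
  by exists m; [rewrite m0 leqW|split=> //; right].
have [th|th] := leP (h ^+ n.+2) t.
  by exists m; [rewrite m0 leqW|split=> //; right; rewrite mE].
by exists n.+2; [rewrite leqnn|split; [exact: ltW|left]].
Qed.

(** For [|t| > 2^-S] the cell is a dyadic interval whose ends are at most twice [|t|]. Smaller
    values get the cell from [- 2^-S] to [2^-S], which costs [4^-S] in the square. *)
Let rounding_cell (t : R) : `|t| <= 2^-1 -> exists lohi : R * R,
  [/\ lohi.1 <= t <= lohi.2,
      (exists2 n, (0 < n <= S)%N & `|lohi.1| = h ^+ n) /\
      lohi.1 ^+ 2 <= 4 * t ^+ 2 + h ^+ (2 * S) &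
      (exists2 n, (0 < n <= S)%N & `|lohi.2| = h ^+ n) /\
      lohi.2 ^+ 2 <= 4 * t ^+ 2 + h ^+ (2 * S) ].
Proof.
move=> t1; have [n /andP[n0 nS] [tn nE]] := halves (normr_ge0 t) t1.
have hp k : 0 <= h ^+ k by rewrite exprn_ge0 ?invr_ge0.
have hh k : h ^+ k = 2 * h ^+ k.+1 by rewrite exprS mulrA divff ?mul1r ?pnatr_eq0.
have t2 : 0 <= 4 * t ^+ 2 by rewrite mulr_ge0 ?sqr_ge0.
case: (eqVneq n S) => [nE'|nS'].
  rewrite nE' in tn.
  exists (- h ^+ S, h ^+ S); split=> /=; first by rewrite -ler_norml.
  - split; first by exists S; rewrite ?S_gt0 ?leqnn// normrN ger0_norm.
    by rewrite sqrrN -exprM mulnC lerDr.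
  - split; first by exists S; rewrite ?S_gt0 ?leqnn// ger0_norm.
    by rewrite -exprM mulnC lerDr.
case: nE => [nE|nE]; first by rewrite nE eqxx in nS'.
have nS2 : (0 < n.+1 <= S)%N by apply/andP; split=> //; rewrite ltn_neqAle nS' nS.
have b1 : (h ^+ n) ^+ 2 <= 4 * t ^+ 2 + h ^+ (2 * S).
  rewrite ler_wpDr// -(real_normK (num_real t)) hh exprMn -natrX ler_wpM2l//.
  by rewrite lerXn2r ?nnegrE.
have b2 : (h ^+ n.+1) ^+ 2 <= 4 * t ^+ 2 + h ^+ (2 * S).
  by apply: le_trans b1; rewrite lerXn2r ?nnegrE// ler_wiXn2l ?invr_ge0// invf_le1// ler1n.
have [t0|t0] := leP 0 t.
  rewrite ger0_norm// in tn nE.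
  exists (h ^+ n.+1, h ^+ n); split=> /=; first by rewrite nE.
    by split=> //; exists n.+1; rewrite ?ger0_norm.
  by split=> //; exists n; rewrite ?n0 ?ger0_norm.
rewrite ltr0_norm// in tn nE.
exists (- h ^+ n, - h ^+ n.+1); split=> /=; first by rewrite lerNl tn lerNr.
  by split; rewrite ?sqrrN//; exists n; rewrite ?n0 ?normrN ?ger0_norm.
by split; rewrite ?sqrrN//; exists n.+1; rewrite ?normrN ?ger0_norm.
Qed.

(** Decoupling reduces the form to disjoint index sets at the cost of a factor 4, rounding reduces
    it to dyadic entries at no cost, and [split_bound] brings the last factor 2. *)
Lemma offdiag_form_bound (lam : 'I_N -> R) : nsq lam <= 4^-1 ->
  `|bil G lam lam| <= 8 * (60 * C * M * (Num.sqrt N%:R * Num.sqrt d%:R) + 8 * B / d%:R).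
Proof.
move=> lam1; rewrite -/err.
(* decoupling: [4 x (1 - x) = 1] at [x = 1/2], and the vertices of the cube are the *)
(* indicators of the subsets [I]                                                    *)
pose f (x : 'I_N -> R) : R :=
  \sum_i \sum_j (0 + 1 * x i) * (lam i * G i j * lam j) * (1 + (-1) * x j).
have fm : multiaffine f.
  by apply: multiaffine_form => i; rewrite G_diag mulr0 mul0r.
have [|x x01 fx] := @box_vertex_norm R N f (fun=> 0) (fun=> 1) (fun=> 2^-1) fm.
  by move=> _; rewrite invr_ge0 ler0n invf_le1// ler1n.
pose I : {set 'I_N} := [set i | x i == 1].
have fhalf : bil G lam lam = 4 * f (fun=> 2^-1).
  rewrite /f /bil mulr_sumr; apply: eq_bigr => i _.
  by rewrite mulr_sumr; apply: eq_bigr => j _; field.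
have xI i : x i = (i \in I)%:R.
  by rewrite inE; case: (x01 i) => ->; rewrite ?eqxx// eq_sym oner_eq0.
(* Restricted to rows in [I] and columns outside, the coefficients vanish on the diagonal, so [g] is
   affine in each entry. Hence some choice of cell ends does not lower [|g|]. *)
pose c i j : R := if (i \in I) && (j \notin I) then G i j else 0.
pose g (v : 'I_N -> R) : R := \sum_i \sum_j (0 + 1 * v i) * c i j * (0 + 1 * v j).
have fg : f x = g lam.
  rewrite /f /g; apply: eq_bigr => i _; apply: eq_bigr => j _.
  by rewrite !xI /c; case: (i \in I); case: (j \in I) => /=; ring.
have gm : multiaffine g.
  by apply: multiaffine_form => i; rewrite /c; case: (i \in I).
have lam_half i : `|lam i| <= 2^-1.
  rewrite -[leRHS]ger0_norm ?invr_ge0// -ler_sqr ?nnegrE// !real_normK ?num_real//.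
  rewrite exprVn -natrX; apply: le_trans lam1; rewrite /nsq (bigD1 i)//= lerDl.
  by apply: sumr_ge0 => j _; exact: sqr_ge0.
have [cell cellP] := choice (fun i => rounding_cell (lam_half i)).
have [|y yv gy] := @box_vertex_norm R N g (fun i => (cell i).1) (fun i => (cell i).2) lam gm.
  by move=> i; have [] := cellP i.
have yP i : (exists n, (0 < n <= S)%N /\ `|y i| = h ^+ n) /\
    y i ^+ 2 <= 4 * lam i ^+ 2 + h ^+ (2 * S).
  have [_ [[n n1 n2] n3] [[m m1 m2] m3]] := cellP i.
  by case: (yv i) => ->; split=> //; [exists n|exists m].
have [s sP] := choice (fun i => (yP i).1).
have y2 : nsq y <= 2.
  (* The sum is at most [4 * 4^-1 + N * 4^-S <= 2]; this is where [N <= 4 ^ S] and the bound [4^-1]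
     on [nsq lam] are used. *)
  apply: (@le_trans _ _ (\sum_(i < N) (4 * lam i ^+ 2 + h ^+ (2 * S)))).
    by apply: ler_sum => i _; exact: (yP i).2.
  rewrite big_split /= -mulr_sumr sumr_const card_ord -[X in _ + X]mulr_natl.
  rewrite exprM.
  have : N%:R * (h ^+ 2) ^+ S <= 1.
    rewrite exprVn -natrX exprVn -natrX ler_pdivrMr ?ltr0n ?expn_gt0//.
    by rewrite mul1r ler_nat.
  move: lam1; rewrite /nsq; lra.
have gE : g y = \sum_(i in I) \sum_(j in ~: I) y i * G i j * y j.
  rewrite /g [RHS]big_mkcond /=; apply: eq_bigr => i _.
  case: (boolP (i \in I)) => iI; last first.
    by rewrite big1// => j _; rewrite /c (negbTE iI) /=; ring.
  rewrite [RHS]big_mkcond /=; apply: eq_bigr => j _.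
  by rewrite /c iI finset.in_setC; case: (j \in I) => /=; ring.
have := split_bound I (fun i => (sP i).1) (fun i => (sP i).2) y2; rewrite -gE => gy2.
rewrite fhalf normrM (ger0_norm (ler0n R 4)); move: fx gy gy2; rewrite fg; lra.
Qed.

End FormBound.

(** * Counting dyadic vectors *)

Section Codes.
Context (R : realType) (N S : nat).
Local Notation h := (2^-1 : R).

Definition sign_code := {ffun 'I_N -> option (bool * 'I_S)}.

Definition sym_val (o : option (bool * 'I_S)) : R :=
  if o is Some (b, k) then (-1) ^+ b * h ^+ k.+1 else 0.

Definition code_val (c : sign_code) : 'I_N -> R := fun i => sym_val (c i).

Lemma dyadic_code (v : 'I_N -> R) : dyadic S v -> exists c : sign_code, v = code_val c.
Proof.
move=> dv.
have H i : exists o : option (bool * 'I_S), v i = sym_val o.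
  case: (dv i) => [->|[s /andP[s0 sS] vs]]; first by exists None.
  have sS' : (s.-1 < S)%N by rewrite prednK.
  exists (Some ((v i < 0)%R, Ordinal sS')).
  rewrite /= prednK// -vs; have [v0|v0] := ltP (v i) 0.
    by rewrite expr1 ltr0_norm// mulN1r opprK.
  by rewrite expr0 mul1r ger0_norm.
have [c cP] := choice H.
by exists [ffun i => c i]; apply: funext => i; rewrite /code_val ffunE.
Qed.

Lemma sym_val_neq0 o : (sym_val o != 0) = (o != None).
Proof.
case: o => [[b k]|] /=; last by rewrite eqxx.
by rewrite mulf_neq0 ?signr_eq0// expf_neq0// invr_eq0 pnatr_eq0.
Qed.

Lemma sum_geom4 : \sum_(j < S) 4 ^+ j.+1 <= 4 / 3 * 4 ^+ S :> R.
Proof.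
elim: S => [|n IH]; first by rewrite big_ord0 expr0; lra.
rewrite big_ord_recr /= [X in _ <= _ * X]exprS; move: IH; rewrite exprS.
have : 0 <= 4 ^+ n :> R by rewrite exprn_ge0.
lra.
Qed.

Lemma expRN_le_inv (x : R) : 0 < x -> expR (- x) <= x^-1.
Proof.
move=> x0; rewrite expRN lef_pV2 ?posrE ?expR_gt0//.
by apply: le_trans (expR_ge1Dx x); rewrite lerDr.
Qed.

(* A counted code [c] satisfies [1 <= th^(|supp c| - m) * expR (k * (2 - nsq c))], and  *)
(* the sum of this weight over all codes factors over the coordinates.                 *)
Lemma code_count (k m : nat) : (0 < k <= N)%N -> (4 ^ S <= 4 * N)%N ->
  #|[set c : sign_code | (nsq (code_val c) <= 2) &&
       (#|[set i | (code_val c i != 0)%R]| <= m)%N]|%:R <=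
  expR (14 * k%:R) * ((N%:R / k%:R) ^+ (2 * m)) :> R.
Proof.
move=> /andP[k0 kN] SN.
have N0 : (0 < N)%N by exact: leq_trans kN.
have kr : 0 < k%:R :> R by rewrite ltr0n.
have Nr : 0 < N%:R :> R by rewrite ltr0n.
pose th : R := (k%:R / N%:R) ^+ 2.
have th0 : 0 < th by rewrite exprn_gt0// divr_gt0.
have th1 : th <= 1.
  by rewrite exprn_ile1// ?divr_ge0 ?ler0n// ler_pdivrMr// mul1r ler_nat.
pose w (o : option (bool * 'I_S)) : R :=
  if o is Some _ then th * expR (- (k%:R * sym_val o ^+ 2)) else 1.
have w0 o : 0 <= w o.
  by case: o => [[b j]|] //=; rewrite mulr_ge0 ?expR_ge0// ltW.
have wE o : w o = th ^+ (o != None) * expR (- (k%:R * sym_val o ^+ 2)).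
  case: o => [p|]; first by rewrite /w expr1.
  by rewrite /= expr0 expr0n mulr0 oppr0 expR0 mul1r.
have prodw (c : sign_code) : \prod_i w (c i) =
    th ^+ #|[set i | (code_val c i != 0)%R]| * expR (- (k%:R * nsq (code_val c))) :> R.
  under eq_bigr do rewrite wE.
  rewrite big_split /=; congr (_ * _).
    rewrite -sum1_card (big_morph (fun n => th ^+ n) (id1 := 1) (op1 := *%R)) //; last exact: exprD.
    rewrite [RHS]big_mkcond /=; apply: eq_bigr => i _.
    rewrite inE /code_val sym_val_neq0; by case: (c i != None).
  by rewrite -expR_sum /nsq mulr_sumr -sumrN.
(* By [exp(-x) <= 1/x] the exponentials sum to at most [(4/3) * 4^S / k <= 6 * N / k]. With
   [th = (k/N)^2] and two signs this adds at most [12 * k / N] to the weight 1 of [None]. *)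
have sumw : \sum_(o : option (bool * 'I_S)) w o <= expR (12 * k%:R / N%:R).
  have -> : \sum_(o : option (bool * 'I_S)) w o =
      1 + 2 * th * \sum_(j < S) expR (- (k%:R * (h ^+ j.+1) ^+ 2)).
    rewrite (bigD1 None)//=; congr (_ + _).
    rewrite (reindex_omap Some id)/=; last by case.
    rewrite (eq_bigl xpredT); last by move=> p; rewrite eqxx.
    rewrite (eq_bigr (fun p => (fun b j => w (Some (b, j))) p.1 p.2)); last by case.
    rewrite -(pair_bigA _ (fun b j => w (Some (b, j)))) /= big_bool /= -big_split mulr_sumr /=.
    apply: eq_bigr => j _; rewrite !exprMn ?sqrr_sign ?sqrrN ?expr1n !mul1r; ring.
  apply: le_trans (expR_ge1Dx _); rewrite lerD2l.
  have : \sum_(j < S) expR (- (k%:R * (h ^+ j.+1) ^+ 2)) <= 6 * N%:R / k%:R.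
    apply: (@le_trans _ _ (\sum_(j < S) 4 ^+ j.+1 / k%:R)).
      apply: ler_sum => j _; apply: le_trans (expRN_le_inv _) _.
        by rewrite mulr_gt0// !exprn_gt0// invr_gt0.
      rewrite invfM -exprM -exprVn invrK mulrC mulnC exprM ler_wpM2r ?invr_ge0//.
      rewrite lerXn2r ?nnegrE//; lra.
    rewrite -mulr_suml ler_wpM2r ?invr_ge0//; apply: le_trans sum_geom4 _.
    have : 4 ^+ S <= 4 * N%:R :> R by rewrite -natrX -natrM ler_nat.
    move: Nr; lra.
  have t2 : 0 <= 2 * th by rewrite mulr_ge0// ltW.
  move=> /(ler_wpM2l t2) /le_trans; apply.
  by rewrite le_eqVlt /th; apply/orP; left; apply/eqP; field; rewrite !gt_eqF.
pose A := [set c : sign_code | (nsq (code_val c) <= 2) &&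
       (#|[set i | (code_val c i != 0)%R]| <= m)%N].
rewrite -/A.
have lowA c : c \in A -> th ^+ m * expR (- (2 * k%:R)) <= \prod_i w (c i).
  rewrite inE => /andP[c2 cm]; rewrite prodw; apply: ler_pM.
  - by rewrite exprn_ge0// ltW.
  - exact: expR_ge0.
  - by apply: ler_wiXn2l => //; exact: ltW.
  - by rewrite ler_expR lerN2 mulrC ler_wpM2r// ltW.
have : #|A|%:R * (th ^+ m * expR (- (2 * k%:R))) <= expR (12 * k%:R).
  apply: (@le_trans _ _ (\sum_(c : sign_code) \prod_i w (c i))).
    rewrite mulr_natl -sumr_const big_mkcond /=; apply: ler_sum => c _.
    case: ifP => [|_]; first exact: lowA.
    by apply: prodr_ge0 => i _.
  rewrite -(bigA_distr_bigA (fun (i : 'I_N) o => w o)) /= prodr_const card_ord.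
  apply: (@le_trans _ _ (expR (12 * k%:R / N%:R) ^+ N)).
    by rewrite lerXn2r ?nnegrE ?expR_ge0// sumr_ge0.
  rewrite -expRM_natl le_eqVlt; apply/orP; left; apply/eqP; congr expR; field; by rewrite gt_eqF.
move=> H.
have p0 : 0 < th ^+ m * expR (- (2 * k%:R)) by apply: mulr_gt0; [exact: exprn_gt0|exact: expR_gt0].
move: H; rewrite -ler_pdivlMr// => /le_trans; apply.
rewrite invfM mulrCA -expRN opprK -expRD mulrC.
rewrite (_ : 12 * k%:R + 2 * k%:R = 14 * k%:R); last by ring.
by rewrite ler_wpM2l ?expR_ge0// /th -exprVn -exprVn -exprM invf_div.
Qed.

(** The left-hand side is one term of the binomial expansion of [(1 + k/N)^N], which is at most
    [exp k]. *)
Lemma bin_pow_le (k : nat) : (k <= N)%N -> (0 < N)%N ->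
  'C(N, k)%:R * (k%:R / N%:R) ^+ k <= expR k%:R :> R.
Proof.
move=> kN N0.
have Nr : 0 < N%:R :> R by rewrite ltr0n.
pose x : R := k%:R / N%:R; have x0 : 0 <= x by rewrite divr_ge0.
apply: (@le_trans _ _ ((x + 1) ^+ N)).
  have nk : (N - k < N.+1)%N by rewrite ltnS leq_subr.
  rewrite exprDn (bigD1 (Ordinal nk))//=.
  rewrite expr1n mulr1 subKn// bin_sub// mulr_natl lerDl.
  by apply: sumr_ge0 => i _; rewrite mulrn_wge0// mulr_ge0// exprn_ge0// addr_ge0.
apply: (@le_trans _ _ (expR x ^+ N)).
  by rewrite lerXn2r ?nnegrE ?expR_ge0 ?addr_ge0// addrC expR_ge1Dx.
rewrite -expRM_natl le_eqVlt; apply/orP; left; apply/eqP; congr expR.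
by rewrite /x; field; rewrite gt_eqF.
Qed.

(** For [#|K| = k] the number of codes cancels the power [2 * D] of [k/N], and [rho] absorbs
    [exp (14 * k)]. One further power of [k/N] pays for the ['C(N, k)] sets; the last one, through
    [(k/N)^k <= k/N] and [k <= 2^k], leaves [2^-k / N]. *)
Lemma union_bound_sum (D : nat) (rho : R) : (0 < N)%N -> (4 ^ S <= 4 * N)%N ->
  0 <= rho -> rho <= expR (- 15) / 4 ->
  \sum_(K : {set 'I_N} | K != finset.set0)
    \sum_(c : sign_code | (nsq (code_val c) <= 2) &&
       (#|[set i | (code_val c i != 0)%R]| <= D * #|K|)%N)
      (rho * (#|K|%:R / N%:R) ^+ (2 * D + 2)) ^+ #|K| <= N%:R^-1.
Proof.
move=> N0 SN rho0 rho1.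
have Nr : 0 < N%:R :> R by rewrite ltr0n.
pose g (k : nat) : R := (1/4) ^+ k * (k%:R / N%:R) ^+ k * 
   (k%:R / N%:R) ^+ k * expR (- k%:R).
have step (K : {set 'I_N}) : K != finset.set0 ->
    \sum_(c : sign_code | (nsq (code_val c) <= 2) &&
       (#|[set i | (code_val c i != 0)%R]| <= D * #|K|)%N)
      (rho * (#|K|%:R / N%:R) ^+ (2 * D + 2)) ^+ #|K| <= g #|K|.
  rewrite -card_gt0 => k0.
  have kN : (#|K| <= N)%N by rewrite -[X in (_ <= X)%N]card_ord max_card.
  set k := #|K| in k0 kN *.
  have kr : 0 < k%:R :> R by rewrite ltr0n.
  rewrite sumr_const -[X in X <= _]mulr_natl.
  have -> : #|[pred c : sign_code | (nsq (code_val c) <= 2) &&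
       (#|[set i | (code_val c i != 0)%R]| <= D * k)%N]| =
    #|[set c : sign_code | (nsq (code_val c) <= 2) &&
       (#|[set i | (code_val c i != 0)%R]| <= D * k)%N]|.
    by apply: eq_card => c; rewrite !inE.
  have p0 : 0 <= (rho * (k%:R / N%:R) ^+ (2 * D + 2)) ^+ k.
    by rewrite exprn_ge0// mulr_ge0// exprn_ge0// divr_ge0.
  have kNk : (0 < k <= N)%N by rewrite k0.
  have H := ler_wpM2r p0 (code_count (D * k) kNk SN).
  apply: le_trans H _.
  have -> : (rho * (k%:R / N%:R) ^+ (2 * D + 2)) ^+ k =
     rho ^+ k * (k%:R / N%:R) ^+ (2 * (D * k)) * (k%:R / N%:R) ^+ k * (k%:R / N%:R) ^+ k.
    by rewrite exprMn -exprM -!mulrA -!exprD; congr (_ * _ ^+ _); lia.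
  have -> : (N%:R / k%:R) ^+ (2 * (D * k)) = ((k%:R / N%:R) ^+ (2 * (D * k)))^-1 :> R.
    by rewrite -exprVn invf_div.
  have q0 : 0 < k%:R / N%:R :> R by rewrite divr_gt0.
  set q : R := k%:R / N%:R in q0 *.
  have -> : expR (14 * k%:R) * (q ^+ (2 * (D * k)))^-1 *
     (rho ^+ k * q ^+ (2 * (D * k)) * q ^+ k * q ^+ k) =
     (expR (14 * k%:R) * rho ^+ k) * q ^+ k * q ^+ k.
    by field; rewrite gt_eqF ?exprn_gt0.
  have : expR (14 * k%:R) * rho ^+ k <= (1/4) ^+ k * expR (- k%:R).
    apply: (@le_trans _ _ (expR (14 * k%:R) * (expR (-15) / 4) ^+ k)).
      by rewrite ler_wpM2l ?expR_ge0// lerXn2r ?nnegrE// (le_trans rho0).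
    rewrite exprMn -expRM_natl mulrA -expRD mulrC div1r.
    rewrite le_eqVlt; apply/orP; left; apply/eqP; congr (_ * expR _); ring.
  have qk : 0 <= q ^+ k by rewrite exprn_ge0// ltW.
  move=> /(ler_wpM2r qk) /(ler_wpM2r qk) /le_trans; apply.
  by rewrite le_eqVlt /g -/q; apply/orP; left; apply/eqP; ring.
apply: (@le_trans _ _ (\sum_(K : {set 'I_N} | K != finset.set0) g #|K|)).
  by apply: ler_sum => K K0; exact: step.
have cN (K : {set 'I_N}) : (#|K| < N.+1)%N.
  by rewrite ltnS -[X in (_ <= X)%N]card_ord max_card.
rewrite (partition_big (fun K => Ordinal (cN K)) (fun k => (0 < k)%N)) /=; last first.
  by move=> K; rewrite card_gt0.
apply: (@le_trans _ _ (\sum_(k < N.+1 | (0 < k)%N) (1/2) ^+ k / N%:R)).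
  apply: ler_sum => k k0.
  rewrite (eq_bigr (fun=> g k)); last by move=> K /andP[_ /eqP <-].
  rewrite sumr_const -[X in X <= _]mulr_natl.
  have -> : #|[pred K : {set 'I_N} | (K != finset.set0) && (Ordinal (cN K) == k)]| = 'C(N, k).
    transitivity #|[set K : {set 'I_N} | #|K| == k]|; last by rewrite card_draws card_ord.
    apply: eq_card => K; rewrite !inE.
    rewrite (_ : (Ordinal (cN K) == k) = (#|K| == k :> nat))//.
    have [e|_] := eqVneq #|K| (k : nat); last by rewrite andbF.
    by rewrite andbT -card_gt0 e.
  have kN : (k <= N)%N by rewrite -ltnS.
  have kr : 0 < (k : nat)%:R :> R by rewrite ltr0n.
  set q : R := k%:R / N%:R.
  have q0 : 0 <= q by rewrite divr_ge0.
  have q1 : q <= 1 by rewrite ler_pdivrMr// mul1r ler_nat.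
  have := bin_pow_le kN N0; rewrite -/q => b1.
  have qk : q ^+ k <= q by rewrite -[leRHS]expr1; apply: ler_wiXn2l.
  have k2 : k%:R <= 2 ^+ k :> R by rewrite -natrX ler_nat ltnW// ltn_expl.
  rewrite /g -/q.
  have -> : 'C(N, k)%:R * ((1 / 4) ^+ k * q ^+ k * q ^+ k * expR (- k%:R)) =
     ('C(N, k)%:R * q ^+ k) * ((1 / 4) ^+ k * q ^+ k * expR (- k%:R)) by ring.
  have r0 : 0 <= (1 / 4) ^+ k * q ^+ k * expR (- k%:R).
    by rewrite !mulr_ge0 ?expR_ge0 ?exprn_ge0//; lra.
  apply: le_trans (ler_wpM2r r0 b1) _.
  rewrite mulrCA -expRD subrr expR0 mulr1.
  apply: (@le_trans _ _ ((1/4) ^+ k * q)).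
    by rewrite ler_wpM2l// exprn_ge0//; lra.
  rewrite /q mulrA ler_wpM2r ?invr_ge0//.
  apply: (@le_trans _ _ ((1/4) ^+ k * 2 ^+ k)).
    by rewrite ler_wpM2l// exprn_ge0//; lra.
  by rewrite -exprMn (_ : 1 / 4 * 2 = 1 / 2)//; lra.
rewrite -mulr_suml -[leRHS]mul1r ler_wpM2r ?invr_ge0//.
suff H n : \sum_(k < n.+1 | (0 < k)%N) (1 / 2) ^+ k = 1 - (1/2) ^+ n :> R.
  by rewrite H gerBl exprn_ge0//; lra.
elim: n => [|n IH].
  by rewrite big_mkcond big_ord_recr big_ord0 /= expr0; ring.
by rewrite big_mkcond big_ord_recr /= -big_mkcond /= IH exprS; field.
Qed.

End Codes.

Local Open Scope classical_set_scope.
Local Open Scope ring_scope.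

(** * Independence *)

Section IndependentPair.
Context d d1 d2 (T : measurableType d) (T1 : measurableType d1) (T2 : measurableType d2).
Context (R : realType) (P : probability T R).
Context (V : {RV P >-> T1}) (U : {RV P >-> T2}).
Hypothesis indVU : forall A B, measurable A -> measurable B ->
  P (V @^-1` A `&` U @^-1` B) = (P (V @^-1` A) * P (U @^-1` B))%E.

Let VU (w : T) : T1 * T2 := (V w, U w).

Let mVU : measurable_fun [set: T] VU.
Proof. by apply: measurable_fun_pair. Qed.

HB.instance Definition _ := isMeasurableFun.Build _ _ _ _ VU mVU.

Lemma joint_law (C : set (T1 * T2)) : measurable C ->
  P (VU @^-1` C) = (distribution P V \x distribution P U)%E C.
Proof.
move=> mC; rewrite (@product_measure_unique _ _ _ _ _ _ _ (distribution P VU))//.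
Qed.

(** By Fubini the probability is the integral over the law of [V] of the section probabilities,
    which are at most [p] and vanish outside [A]. *)
Lemma indep_conditional (A : set T1) (C : set (T1 * T2)) (p : R) :
  0 <= p -> measurable A -> measurable C ->
  (forall z x, C (z, x) -> A z) ->
  (forall z, (P (U @^-1` xsection C z) <= p%:E)%E) ->
  (P [set w | C (V w, U w)] <= p%:E * P (V @^-1` A))%E.
Proof.
move=> p0 mA mC CA Cp.
rewrite (_ : [set w | _] = VU @^-1` C)// joint_law// /product_measure1.
apply: (@le_trans _ _ (\int[distribution P V]_z (p%:E * (\1_A z)%:E))%E).
  apply: ge0_le_integral => //.
  - exact: measurable_fun_xsection.
  - by apply: measurable_funeM; exact/measurable_EFinP/measurable_indic.
  - move=> z _ /=; rewrite indicE; have [Az|nAz] := boolP (z \in A).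
      by rewrite mule1; exact: Cp.
    rewrite mule0 (_ : xsection C z = set0) ?measure0//.
    rewrite -subset0 => x; rewrite /xsection /= => /set_mem /CA Az.
    by move: nAz; rewrite notin_setE.
rewrite ge0_integralZl//; last exact/measurable_EFinP/measurable_indic.
by rewrite integral_indic// setIT.
Qed.

End IndependentPair.

Section LeaveOneOut.
Context d d' (T : measurableType d) (E : measurableType d') (R : realType).
Context (P : probability T R) (N : nat) (X : 'I_N -> {RV P >-> E}).
Hypothesis indX : forall B : 'I_N -> set E, (forall i, measurable (B i)) ->
    P [set w | forall i, B i (X i w)] = (\prod_(i < N) P (X i @^-1` B i))%E.
Context (i0 : 'I_N) (e0 : E).

(** The coordinate [i0] is overwritten by the constant [e0], which keeps the index type and avoids
    tuples of length [N - 1]. *)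
Definition others (w : T) : N.-tuple E := [tuple if j == i0 then e0 else X j w | j < N].

Lemma measurable_others : measurable_fun [set: T] others.
Proof.
apply/measurable_fun_tnthP => j.
rewrite (_ : _ \o _ = fun w => if j == i0 then e0 else X j w); last first.
  by apply/funext => w /=; rewrite tnth_mktuple.
by case: eqP.
Qed.

HB.instance Definition _ := isMeasurableFun.Build _ _ _ _ others measurable_others.

Let box : set (set (N.-tuple E)) := [set B | exists C : 'I_N -> set E,
  (forall j, measurable (C j)) /\ B = [set z | forall j, C j (tnth z j)]].

Let box_measurable B : box B -> measurable B.
Proof.
move=> [C [mC ->]].
rewrite (_ : [set z | _] = \bigcap_(j in [set: 'I_N]) ((fun z : N.-tuple E => tnth z j) @^-1` C j)).
  apply: fin_bigcap_measurable; first exact: finite_finset.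
  by move=> j _; rewrite -[X in measurable X]setTI; exact: measurable_tnth.
by apply/seteqP; split=> [z Cz j _|z Cz j]; [exact: Cz|exact: Cz].
Qed.

Let box_generates : @measurable _ (N.-tuple E) = <<s box >>.
Proof.
apply/seteqP; split; last first.
  by apply: smallest_sub; [exact: sigma_algebra_measurable|exact: box_measurable].
apply: smallest_sub; first exact: smallest_sigma_algebra.
move=> B; rewrite -bigcup_seq/= => -[j _ [C mC <-]].
apply: sub_sigma_algebra; exists (fun k => if k == j then C else setT); split.
  by move=> k; case: ifP.
apply/seteqP; split=> [z [_ Cz] k|z Cz]; first by case: eqP => // ->.
by split=> //; have := Cz j; rewrite eqxx.
Qed.

Let box_setI : setI_closed box.
Proof.
move=> _ _ [C [mC ->]] [D [mD ->]]; exists (fun j => C j `&` D j); split.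
  by move=> j; exact: measurableI.
by apply/seteqP; split=> [z [Cz Dz] j|z CDz]; [split|split=> j; have [] := CDz j].
Qed.

Let rem_box (C : 'I_N -> set E) (A : set E) :
  (forall j, measurable (C j)) -> measurable A ->
  P (others @^-1` [set z | forall j, C j (tnth z j)] `&` X i0 @^-1` A) =
  (P (others @^-1` [set z | forall j, C j (tnth z j)]) * P (X i0 @^-1` A))%E.
Proof.
move=> mC mA.
(* The coordinate [i0] of [others] is always [e0]: if [C i0] misses [e0], both sides are 0;
   otherwise this constraint is void. *)
have [Ce|nCe] := pselect (C i0 e0); last first.
  have -> : others @^-1` [set z | forall j, C j (tnth z j)] = set0.
    rewrite -subset0 => w /= /(_ i0); by rewrite tnth_mktuple eqxx.
  by rewrite set0I measure0 mul0e.
pose B (A' : set E) j := if j == i0 then A' else C j.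
have mB A' j : measurable A' -> measurable (B A' j) by rewrite /B; case: ifP.
have E1 : others @^-1` [set z | forall j, C j (tnth z j)] `&` X i0 @^-1` A =
   [set w | forall j, B A j (X j w)].
  apply/seteqP; split=> [w [Cw Aw] j|w Bw].
    rewrite /B; case: eqP => [->//|/eqP ji]; have := Cw j.
    by rewrite tnth_mktuple (negbTE ji).
  split=> [j|]; last by have := Bw i0; rewrite /B eqxx.
  rewrite /= tnth_mktuple; have := Bw j; rewrite /B; case: eqP => // -> _; exact: Ce.
have E2 : others @^-1` [set z | forall j, C j (tnth z j)] =
   [set w | forall j, B setT j (X j w)].
  apply/seteqP; split=> [w Cw j|w Bw j].
    rewrite /B; case: eqP => [->//|/eqP ji]; have := Cw j.
    by rewrite tnth_mktuple (negbTE ji).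
  rewrite /= tnth_mktuple; have := Bw j; rewrite /B; case: eqP => // -> _; exact: Ce.
rewrite E1 E2 !indX; try by move=> j; exact: mB.
rewrite (bigD1 i0)//= [in RHS](bigD1 i0)//= /B eqxx preimage_setT probability_setT mul1e muleC.
congr (_ * _)%E; apply: eq_bigr => j ji; by rewrite (negbTE ji).
Qed.

(** For fixed [A] both sides are finite measures in [B]. They agree on boxes, which generate the
    sigma-algebra and are stable under intersection. *)
Lemma indep_others (B : set (N.-tuple E)) (A : set E) : measurable B -> measurable A ->
  P (others @^-1` B `&` X i0 @^-1` A) = (P (others @^-1` B) * P (X i0 @^-1` A))%E.
Proof.
move=> mB mA.
have mXA : measurable (X i0 @^-1` A).
  by exact: measurable_funPTI.
have PA0 : (0 <= fine (P (X i0 @^-1` A)))%R by exact: fine_ge0.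
pose m1 := pushforward (mrestr P mXA) others.
pose m2 := mscale (NngNum PA0) (distribution P others).
have m2E D : m2 D = (P (others @^-1` D) * P (X i0 @^-1` A))%E.
  by rewrite -[LHS]/(_%:E * _)%E /= fineK ?fin_num_measure// muleC.
have H : forall B, measurable B -> m1 B = m2 B.
  move=> D mD.
  apply: (measure_unique box (fun=> setT) box_generates box_setI) => //.
  - by move=> _; exists (fun=> setT); split=> //; apply/seteqP; split.
  - by rewrite bigcup_const//; exists 0%N.
  - move=> _ [C [mC ->]]; rewrite -[RHS]/(m2 _) m2E.
    exact: rem_box.
  - move=> k; apply: (@le_lt_trans _ _ 1%E); last exact: ltry.
    rewrite -[X in (X <= _)%E]/(P (_ `&` _)); apply: probability_le1.
    by apply: measurableI => //; exact: (measurable_funPTI others).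
by have := H _ mB; rewrite m2E.
Qed.

End LeaveOneOut.

Definition comb (R : realType) (p N : nat) (x : 'I_N -> p.-tuple R) (v : 'I_N -> R) : 'cV[R]_p :=
  \sum_j v j *: vec (x j).

Section VectorMeasurability.
Context d (T : measurableType d) (R : realType) (p : nat).

Definition mvec (u : T -> 'cV[R]_p) : Prop :=
  forall i, measurable_fun [set: T] (fun w => u w i 0).

Lemma mvec_vec (f : T -> p.-tuple R) : measurable_fun setT f -> mvec (fun w => vec (f w)).
Proof.
move=> mf i; rewrite (_ : (fun _ => _) = (fun z => tnth z i) \o f).
  by apply: measurableT_comp mf; exact: measurable_tnth.
by apply: funext => w; rewrite /= mxE.
Qed.

Lemma mvec_comb N (f : 'I_N -> T -> p.-tuple R) (v : 'I_N -> R) :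
  (forall j, measurable_fun setT (f j)) -> mvec (fun w => comb (fun j => f j w) v).
Proof.
move=> mf i.
rewrite (_ : (fun _ => _) = fun w => \sum_(j < N) v j * vec (f j w) i 0).
  apply: measurable_sum => j; apply: measurable_funM; first exact: measurable_cst.
  exact: mvec_vec (mf j) i.
by apply: funext => w; rewrite /comb summxE; apply: eq_bigr => j _; rewrite mxE.
Qed.

Lemma measurable_dotp (u v : T -> 'cV[R]_p) : mvec u -> mvec v ->
  measurable_fun setT (fun w => dotp (u w) (v w)).
Proof. by move=> mu mv; apply: measurable_sum => i; apply: measurable_funM. Qed.

Lemma measurable_norm2 (u : T -> 'cV[R]_p) : mvec u ->
  measurable_fun setT (fun w => norm2 (u w)).
Proof.
move=> mu; apply: (@measurableT_comp _ _ _ _ _ _ (@Num.sqrt R)).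
  by apply: continuous_measurable_fun; exact: sqrt_continuous.
by apply: measurable_sum => i; exact: measurable_funX.
Qed.

Lemma measurable_ltr_set (a b : T -> R) : measurable_fun setT a -> measurable_fun setT b ->
  measurable [set w | a w < b w].
Proof.
move=> ma mb; rewrite (_ : [set w | _] = (fun w => b w - a w) @^-1` `]0, +oo[).
  rewrite -[X in measurable X]setTI; apply: measurable_funB => //.
by apply/seteqP; split=> w /=; rewrite in_itv /= andbT subr_gt0.
Qed.

Lemma measurable_ler_set (a b : T -> R) : measurable_fun setT a -> measurable_fun setT b ->
  measurable [set w | a w <= b w].
Proof.
move=> ma mb; rewrite (_ : [set w | _] = ~` [set w | b w < a w]).
  by apply: measurableC; exact: measurable_ltr_set.
by apply/seteqP; split=> w /=; rewrite leNgt => /negP.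
Qed.

Lemma measurable_finI (I : finType) (Q : pred I) (A : I -> set T) :
  (forall i, Q i -> measurable (A i)) -> measurable [set w | forall i, Q i -> A i w].
Proof.
move=> mA.
rewrite (_ : [set w | _] = \bigcap_(i in [set i | Q i]) A i).
  by apply: fin_bigcap_measurable => //; exact: finite_finset.
by apply/seteqP; split=> w Aw i Qi; exact: Aw.
Qed.

End VectorMeasurability.

Section LargeTogether.
Context d (T : measurableType d) (R : realType) (P : probability T R) (p N : nat).
Context (X : 'I_N -> {RV P >-> p.-tuple R}).
Hypothesis indX : independent_rvs P X.
Context (s c : R).
Hypothesis tail : forall i y,
  (P (X i @^-1` [set x | (s * norm2 y < `|dotp (vec x) y|)%R]) <= c%:E)%E.

Let exceed (v : 'I_N -> R) (K : {set 'I_N}) : set T :=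
  [set w | forall i, i \in K ->
     s * norm2 (comb (fun j => X j w) v) < `|dotp (vec (X i w)) (comb (fun j => X j w) v)|].

(** As [v] vanishes on [K], the vector [A v] does not depend on the [X i] with [i] in [K].
    Conditioning on all vectors but one such [X i] freezes [A v] and the events of the other
    indices, and [tail] gives one factor [c]. *)
Lemma large_together (v : 'I_N -> R) (K : {set 'I_N}) : (forall i, i \in K -> v i = 0) ->
  (P [set w | forall i, i \in K ->
     (s * norm2 (comb (fun j => X j w) v) < `|dotp (vec (X i w)) (comb (fun j => X j w) v)|)%R]
   <= (c ^+ #|K|)%:E)%E.
Proof.
rewrite -/(exceed v K).
have [n] := ubnP #|K|; elim: n K => // n IH K.
rewrite ltnS => Kn vK.
have [K0|[i iK]] := set_0Vmem K.
  rewrite K0 cards0 expr0; apply: le_trans (probability_le1 _ _) _ => //.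
  apply: (measurable_finI (Q := fun i => i \in finset.set0)) => i; by rewrite inE.
have c0 : 0 <= c by rewrite -lee_fin; exact: le_trans (measure_ge0 _ _) (tail i 0).
pose K' := K :\ i.
have cK : #|K| = #|K'|.+1 by rewrite (cardsD1 i) iK.
have vK' k : k \in K' -> v k = 0 by rewrite in_setD1 => /andP[_]; exact: vK.
have IHK' : (P (exceed v K') <= (c ^+ #|K'|)%:E)%E.
  by apply: IH => //; rewrite -cK.
pose e0 : p.-tuple R := [tuple 0 | _ < p].
pose V := others X i e0.
pose y (z : N.-tuple (p.-tuple R)) : 'cV[R]_p := comb (tnth z) v.
(* The dummy [e0] sits at the index [i], where [v] vanishes, so [A v] is recovered from the other
   vectors. *)
have yV w : y (V w) = comb (fun j => X j w) v.
  apply: eq_bigr => j _; rewrite /V /others tnth_mktuple; case: eqP => [->|//].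
  by rewrite vK// !scale0r.
have my : mvec y by apply: mvec_comb => j; exact: measurable_tnth.
pose A : set (N.-tuple (p.-tuple R)) :=
  [set z | forall k, k \in K' -> s * norm2 (y z) < `|dotp (vec (tnth z k)) (y z)|].
pose C : set (N.-tuple (p.-tuple R) * p.-tuple R) :=
  [set zx | A zx.1 /\ s * norm2 (y zx.1) < `|dotp (vec zx.2) (y zx.1)|].
have mA : measurable A.
  apply: (measurable_finI (Q := fun k => k \in K')) => k _.
  apply: measurable_ltr_set.
    by apply: measurable_funM => //; exact: measurable_norm2.
  apply: measurableT_comp => //; apply: measurable_dotp => //.
  by apply: mvec_vec; exact: measurable_tnth.
have mC : measurable C.
  apply: measurableI.
    by have := @measurable_fst _ _ (N.-tuple (p.-tuple R)) (p.-tuple R) measurableT _ mA; rewrite setTI.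
  have my1 : mvec (fun zx : N.-tuple (p.-tuple R) * p.-tuple R => y zx.1).
    by move=> k; apply: (measurableT_comp (my k)); exact: measurable_fst.
  apply: measurable_ltr_set.
    by apply: measurable_funM => //; exact: (measurable_norm2 my1).
  apply: measurableT_comp => //; apply: (measurable_dotp _ my1).
  exact: mvec_vec.
have EK : exceed v K = [set w | C (V w, X i w)].
  apply/seteqP; split=> w /=.
    move=> Ew; split=> [k kK'|]; last by rewrite yV; exact: Ew.
    have [ki kK] := setD1P kK'.
    by rewrite yV /V /others tnth_mktuple (negbTE ki); exact: Ew.
  move=> [Aw]; rewrite [X in X -> _]/= yV => Ciw k kK; have [->//|ki] := eqVneq k i.
  have kK' : k \in K' by rewrite in_setD1 ki.
  by have := Aw k kK'; rewrite yV /V /others tnth_mktuple (negbTE ki).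
have EK' : exceed v K' = V @^-1` A.
  apply/seteqP; split=> w /= Ew k kK'; have [ki kK] := setD1P kK'; have := Ew k kK';
  by rewrite yV /V /others tnth_mktuple (negbTE ki).
rewrite EK cK exprS EFinM.
apply: (@le_trans _ _ (c%:E * P (V @^-1` A))%E); last first.
  by rewrite lee_wpmul2l ?lee_fin// -EK'.
apply: (indep_conditional (V := V) (U := X i)) => //.
- by move=> B D mB mD; exact: (indep_others indX).
- by move=> z x [].
- move=> z; apply: le_trans (tail i (y z)).
  apply: le_measure; rewrite ?inE.
  + by apply: measurable_funPTI; exact: measurable_xsection.
  + apply: measurable_funPTI; apply: measurable_ltr_set; first exact: measurable_cst.
    apply: measurableT_comp => //; apply: measurable_dotp; first exact: mvec_vec.
    by move=> k; exact: measurable_cst.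
  + by move=> w; rewrite /= /xsection /= => /set_mem[].
Qed.

End LargeTogether.

(** * Moments of marginals *)

Section Euclidean.
Context (R : realType).

Lemma sum_cauchy_schwarz (I : finType) (a b : I -> R) :
  (\sum_i a i * b i) ^+ 2 <= (\sum_i a i ^+ 2) * (\sum_i b i ^+ 2).
Proof.
set A := \sum_i a i ^+ 2; set B := \sum_i b i ^+ 2; set C := \sum_i a i * b i.
have B0 : 0 <= B by apply: sumr_ge0 => i _; exact: sqr_ge0.
have [B1|B1] := eqVneq B 0.
  have b0 i : b i = 0.
    apply/eqP; rewrite -sqrf_eq0 eq_le sqr_ge0 andbT -B1 /B (bigD1 i)//= lerDl.
    by apply: sumr_ge0 => j _; exact: sqr_ge0.
  by rewrite /C big1 ?expr0n ?B1 ?mulr0// => i _; rewrite b0 mulr0.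
have Bp : 0 < B by rewrite lt_neqAle eq_sym B1.
have : 0 <= \sum_i (B * a i - C * b i) ^+ 2 by apply: sumr_ge0 => i _; exact: sqr_ge0.
have -> : \sum_i (B * a i - C * b i) ^+ 2 = B * (A * B - C ^+ 2).
  transitivity (\sum_i (B ^+ 2 * a i ^+ 2 - 2 * B * C * (a i * b i) + C ^+ 2 * b i ^+ 2)).
    by apply: eq_bigr => i _; ring.
  by rewrite !big_split /= sumrN -!mulr_sumr -/A -/B -/C; ring.
by rewrite pmulr_rge0// subr_ge0.
Qed.

Lemma norm2_ge0 p (u : 'cV[R]_p) : 0 <= norm2 u. Proof. exact: sqrtr_ge0. Qed.

Lemma norm2_sqr p (u : 'cV[R]_p) : norm2 u ^+ 2 = \sum_i u i 0 ^+ 2.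
Proof. by rewrite sqr_sqrtr// sumr_ge0// => i _; exact: sqr_ge0. Qed.

Lemma dotp_self p (u : 'cV[R]_p) : dotp u u = norm2 u ^+ 2.
Proof. by rewrite norm2_sqr /dotp; apply: eq_bigr => i _; rewrite expr2. Qed.

Lemma norm2_0 p : norm2 (0 : 'cV[R]_p) = 0.
Proof. by rewrite /norm2 big1 ?sqrtr0// => i _; rewrite mxE expr0n. Qed.

Lemma dotp_le p (u v : 'cV[R]_p) : `|dotp u v| <= norm2 u * norm2 v.
Proof.
rewrite -ler_sqr ?nnegrE ?mulr_ge0 ?norm2_ge0//.
by rewrite real_normK ?num_real// exprMn !norm2_sqr sum_cauchy_schwarz.
Qed.

Lemma norm2Z p (a : R) (u : 'cV[R]_p) : norm2 (a *: u) = `|a| * norm2 u.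
Proof.
rewrite /norm2 -sqrtr_sqr -sqrtrM ?sqr_ge0//; congr Num.sqrt.
by rewrite mulr_sumr; apply: eq_bigr => i _; rewrite mxE exprMn.
Qed.

Lemma opnorm_has_sup p (M : 'M[R]_p) :
  has_sup [set norm2 (M *m v) | v in [set v | norm2 v <= 1]].
Proof.
split; first by exists (norm2 (M *m 0)); exists 0 => //=; rewrite norm2_0.
exists (Num.sqrt (\sum_i \sum_j M i j ^+ 2)) => _ [v /= v1 <-].
rewrite ler_wsqrtr//; apply: ler_sum => i _; rewrite mxE.
apply: le_trans (sum_cauchy_schwarz _ _) _.
rewrite ler_piMr ?sumr_ge0// => [j _|]; first exact: sqr_ge0.
by rewrite -norm2_sqr exprn_ile1// norm2_ge0.
Qed.

Lemma opnorm_ge0 p (M : 'M[R]_p) : 0 <= opnorm M.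
Proof.
apply: le_trans (norm2_ge0 (M *m 0)) _; apply: ub_le_sup; first by case: (opnorm_has_sup M).
by exists 0 => //=; rewrite norm2_0.
Qed.

Lemma norm2_mulmx_le p (M : 'M[R]_p) (v : 'cV[R]_p) : norm2 (M *m v) <= opnorm M * norm2 v.
Proof.
have [v0|v0] := eqVneq (norm2 v) 0.
  have -> : v = 0.
    apply/matrixP => i j; rewrite ord1 mxE; apply/eqP.
    rewrite -sqrf_eq0 eq_le sqr_ge0 andbT.
    have <- : norm2 v ^+ 2 = 0 by rewrite v0 expr0n.
    rewrite norm2_sqr (bigD1 i)//= lerDl.
    by apply: sumr_ge0 => k _; exact: sqr_ge0.
  by rewrite mulmx0 !norm2_0 mulr0.
have vp : 0 < norm2 v by rewrite lt_neqAle eq_sym v0 norm2_ge0.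
rewrite -ler_pdivrMr//.
have -> : norm2 (M *m v) / norm2 v = norm2 (M *m ((norm2 v)^-1 *: v)).
  by rewrite -scalemxAr norm2Z ger0_norm ?invr_ge0 ?norm2_ge0// mulrC.
apply: ub_le_sup; first by case: (opnorm_has_sup M).
exists ((norm2 v)^-1 *: v) => //=.
by rewrite norm2Z ger0_norm ?invr_ge0 ?norm2_ge0// mulVf.
Qed.

End Euclidean.

Section Moments.
Context d (T : measurableType d) (R : realType) (P : probability T R) (p : nat).

Lemma integral_quadratic (c : 'I_p -> T -> R) (m a : 'I_p -> 'I_p -> R) :
  (forall i j, P.-integrable [set: T] (EFin \o (fun w => c i w * c j w))) ->
  (forall i j, (\int[P]_w (c i w * c j w)%:E = (m i j)%:E)%E) ->
  (\int[P]_w (\sum_i \sum_j a i j * (c i w * c j w))%:E =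
   (\sum_i \sum_j a i j * m i j)%:E)%E.
Proof.
move=> cI cm.
have cI' i j : P.-integrable [set: T] (fun w => (a i j)%:E * (c i w * c j w)%:E)%E.
  by apply: integrableZl => //; exact: cI.
under eq_integral => w _.
  rewrite -sumEFin; under eq_bigr => i _.
    rewrite -sumEFin; under eq_bigr => j _ do rewrite EFinM.
    over.
  over.
rewrite integral_sum//=; last first.
  by move=> i; apply: integrable_sum => //= j _; exact: cI'.
rewrite -sumEFin; apply: eq_bigr => i _.
rewrite integral_sum//= -sumEFin; apply: eq_bigr => j _.
by rewrite integralZl//; [rewrite cm -EFinM|exact: cI].
Qed.

Context (X : {RV P >-> p.-tuple R}).
Hypothesis X2 : square_integrable P X.

Let G := second_moment_mx P X.

Let cI i j : P.-integrable [set: T] (EFin \o (fun w => coordinate X i w * coordinate X j w)).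
Proof. exact/Lfun1_integrable/Lfun2_mul_Lfun1. Qed.

Let cm i j : (\int[P]_w (coordinate X i w * coordinate X j w)%:E = (G i j)%:E)%E.
Proof.
rewrite mxE fineK; first by rewrite unlock.
by apply: expectation_fin_num; exact: Lfun2_mul_Lfun1.
Qed.

Lemma integral_marginal_sqr (v : 'cV[R]_p) :
  (\int[P]_w (marginal X v w ^+ 2)%:E = (dotp (G *m v) v)%:E)%E.
Proof.
have := integral_quadratic (fun i j => v i 0 * v j 0) cI cm.
have -> : (\sum_i \sum_j v i 0 * v j 0 * G i j) = dotp (G *m v) v.
  apply: eq_bigr => i _; rewrite mxE mulr_suml; apply: eq_bigr => j _; ring.
move=> <-; apply: eq_integral => w _; congr EFin.
rewrite /marginal /dotp expr2 mulr_suml; apply: eq_bigr => i _.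
rewrite mulr_sumr; apply: eq_bigr => j _; rewrite /coordinate !mxE; ring.
Qed.

Lemma lstar_sqr : lstar P X ^+ 2 = \tr G.
Proof.
have -> : lstar P X = Num.sqrt (\tr G).
  rewrite /lstar unlock; congr Num.sqrt.
  have := integral_quadratic (fun i j => (i == j)%:R) cI cm.
  have -> : (\sum_i \sum_j (i == j)%:R * G i j) = \tr G.
    apply: eq_bigr => i _; rewrite (bigD1 i)//= eqxx mul1r big1 ?addr0// => j ji.
    by rewrite eq_sym (negbTE ji) mul0r.
  move=> E; transitivity (fine (\tr G)%:E) => //; rewrite -E; congr fine.
  apply: eq_integral => w _; congr EFin; rewrite norm2_sqr; apply: eq_bigr => i _.
  rewrite (bigD1 i)//= eqxx mul1r big1 ?addr0.
    by rewrite /coordinate mxE expr2.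
  by move=> j ji; rewrite eq_sym (negbTE ji) mul0r.
rewrite sqr_sqrtr//; apply: sumr_ge0 => i _; rewrite -lee_fin -cm.
by apply: integral_ge0 => w _; rewrite lee_fin -expr2 sqr_ge0.
Qed.

Lemma measurable_marginal (v : 'cV[R]_p) : measurable_fun [set: T] (marginal X v).
Proof.
apply: measurable_dotp; first exact: mvec_vec.
by move=> k; exact: measurable_cst.
Qed.

(** The second moment of the marginal is the quadratic form of [G] at [v], at most
    [opnorm G * norm2 v ^+ 2] by Cauchy-Schwarz. *)
Lemma Lnorm2_marginal (v : 'cV[R]_p) :
  ('N[P]_(2%:E)[EFin \o marginal X v] <= (Num.sqrt (opnorm G) * norm2 v)%:E)%E.
Proof.
rewrite unlock.
have -> : (\int[P]_x `|(EFin \o marginal X v) x| `^ 2 = (dotp (G *m v) v)%:E)%E.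
  rewrite -integral_marginal_sqr; apply: eq_integral => w _ /=.
  by rewrite powR_mulrn// real_normK ?num_real.
have q0 : 0 <= dotp (G *m v) v.
  rewrite -lee_fin -integral_marginal_sqr.
  by apply: integral_ge0 => w _; rewrite lee_fin sqr_ge0.
rewrite poweR_EFin lee_fin powR12_sqrt//.
rewrite -(ger0_norm (norm2_ge0 v)) -sqrtr_sqr -sqrtrM ?opnorm_ge0// ler_wsqrtr//.
apply: le_trans (ler_norm _) _; apply: le_trans (dotp_le _ _) _.
by rewrite expr2 mulrA ler_wpM2r ?norm2_ge0// norm2_mulmx_le.
Qed.

Lemma tail_of_Lnorm (n : nat) (f : T -> R) (a t : R) : (0 < n)%N ->
  measurable_fun [set: T] f -> 0 <= a -> 0 < t ->
  ('N[P]_(n%:R%:E)[EFin \o f] <= a%:E)%E ->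
  (P [set w | (t < `|f w|)%R] <= ((a / t) ^+ n)%:E)%E.
Proof.
move=> n0 mf a0 t0 fa.
pose F : {RV P >-> R} := HB.pack f (isMeasurableFun.Build _ _ _ _ f mf).
have H := @markov _ _ _ P F (fun x => x ^+ n) t t0.
have nr : n%:R != 0 :> R by rewrite pnatr_eq0 -lt0n.
have E : ('E_P[(fun x : R => (x ^+ n)%R) \o (fun x : R => `|x|%R) \o F] <= (a ^+ n)%:E)%E.
  rewrite unlock.
  have -> : (\int[P]_w (((fun x : R => (x ^+ n)%R) \o (fun x : R => `|x|%R) \o F) w)%:E =
     'N[P]_(n%:R%:E)[EFin \o f] `^ n%:R)%E.
    rewrite poweR_Lnorm//; apply: eq_integral => w _ /=.
    by rewrite powR_mulrn.
  have fin : ('N[P]_(n%:R%:E)[EFin \o f])%E \is a fin_num.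
    by rewrite ge0_fin_numE ?Lnorm_ge0// (le_lt_trans fa)// ltry.
  rewrite -(fineK fin) poweR_EFin lee_fin powR_mulrn ?fine_ge0 ?Lnorm_ge0//.
  by rewrite lerXn2r ?nnegrE ?fine_ge0 ?Lnorm_ge0// -lee_fin fineK.
have {}H := le_trans (H _ _ _) E.
have tn : 0 < t ^+ n by rewrite exprn_gt0.
rewrite expr_div_n EFinM lee_pdivlMr//.
apply: (@le_trans _ _ (P [set x | (t%:E <= `|(F x)%:E|)%E] * (t ^+ n)%:E)%E).
  apply: lee_wpmul2r; first by rewrite lee_fin ltW.
  apply: le_measure; rewrite ?inE.
  - by apply: measurable_ltr_set; [exact: measurable_cst|exact: measurableT_comp].
  - rewrite (_ : [set x | _] = [set x | t <= `|f x|]).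
      by apply: measurable_ler_set; [exact: measurable_cst|exact: measurableT_comp].
    by apply/seteqP; split=> w /=; rewrite lee_fin.
  - by move=> w /= /ltW; rewrite lee_fin.
rewrite muleC; apply: H.
- exact: exprn_measurable.
- by move=> r r0; exact: exprn_ge0.
- by move=> x y; rewrite !nnegrE => x0 y0 xy; rewrite lerXn2r ?nnegrE.
Qed.

End Moments.

(** * The Dvoretzky dimension *)

Section StandardNormal.
Context (R : realType).
Local Notation mu := (@lebesgue_measure R).
Local Notation nu := (@normal_prob R 0 1).

Let mpdf (s : R) : measurable_fun [set: R] (fun x => (normal_pdf 0 s x)%:E).
Proof. by apply/measurable_EFinP; exact: measurable_normal_pdf. Qed.

Lemma normal_prob_density (f : R -> \bar R) : measurable_fun [set: R] f ->
  (forall x, 0 <= f x)%E ->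
  (\int[nu]_x f x = \int[mu]_x (f x * (normal_pdf 0 1 x)%:E))%E.
Proof.
move=> mf f0.
have dom : nu `<< mu := normal_prob_dominates 0 1.
have df := Radon_Nikodym_SigmaFinite.f_integrable dom.
rewrite -(Radon_Nikodym_SigmaFinite.change_of_variables dom)//.
have ae : ae_eq mu [set: R] (Radon_Nikodym_SigmaFinite.f nu mu)
    (fun x => (normal_pdf 0 1 x)%:E).
  apply: integral_ae_eq => //.
    exact: mpdf.
  by move=> E _ mE; rewrite -Radon_Nikodym_SigmaFinite.f_integral.
apply: ae_eq_integral => //.
- by apply: emeasurable_funM => //; exact: measurable_int df.
- apply: emeasurable_funM => //.
  exact: mpdf.
- by move: ae; apply: filterS => x /= H xT; rewrite H.
Qed.

(** Since [x^2 / 4 <= exp (x^2 / 4)], the integrand is at most a multiple of the normal density of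
    variance 2, whose integral is 1. *)
Lemma normal_second_moment_lty : (\int[nu]_x (x ^+ 2)%:E < +oo)%E.
Proof.
have mX2 : measurable_fun [set: R] (fun x : R => (x ^+ 2)%:E).
  by apply/measurable_EFinP; exact: exprn_measurable.
rewrite normal_prob_density//; last by move=> x; rewrite lee_fin sqr_ge0.
pose s : R := Num.sqrt 2.
have s0 : s != 0 by rewrite sqrtr_eq0 -ltNge.
have s2 : s ^+ 2 = 2 by rewrite sqr_sqrtr.
have ps : 0 < normal_peak s by exact: normal_peak_gt0.
pose k : R := 4 * normal_peak 1 / normal_peak s.
have k0 : 0 <= k by rewrite !mulr_ge0 ?invr_ge0 ?normal_peak_ge0.
apply: (@le_lt_trans _ _ (\int[mu]_x (k%:E * (normal_pdf 0 s x)%:E))%E).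
  apply: ge0_le_integral => //.
  - by move=> x _; rewrite mule_ge0 ?lee_fin ?sqr_ge0 ?normal_pdf_ge0.
  - by apply: emeasurable_funM => //; exact: mpdf.
  - by apply: measurable_funeM; exact: mpdf.
  - move=> x _; rewrite -!EFinM lee_fin.
    have pE t : t != 0 -> normal_pdf 0 t x = normal_peak t * normal_fun 0 t x.
      by move=> t0; rewrite normal_pdfE.
    rewrite !pE ?oner_eq0//.
    have -> : k * (normal_peak s * normal_fun 0 s x) = normal_peak 1 * (4 * normal_fun 0 s x).
      by rewrite /k; field; rewrite gt_eqF.
    rewrite mulrCA ler_wpM2l ?normal_peak_ge0//.
    rewrite /normal_fun s2 expr1n subr0.
    have -> : - x ^+ 2 / (1 *+ 2) = - x ^+ 2 / (2 *+ 2) + - (x ^+ 2 / 4) by field.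
    rewrite expRD mulrCA (mulrC 4) ler_wpM2l ?expR_ge0//.
    have := expR_ge1Dx (x ^+ 2 / 4); rewrite expRN.
    rewrite ler_pdivrMr ?expR_gt0//; lra.
rewrite ge0_integralZl//; last 2 first.
- exact: mpdf.
- by move=> x _; rewrite lee_fin normal_pdf_ge0.
by rewrite integral_normal_pdf mule1 ltry.
Qed.

Lemma normal_probN (A : set R) : measurable A -> nu (-%R @^-1` A) = nu A.
Proof.
move=> mA; rewrite /normal_prob.
have mN : measurable (-%R @^-1` A : set R).
  by rewrite -[X in measurable X]setTI; exact: oppr_measurable.
have E : (\int[mu]_(x in A) (normal_pdf 0 1 x)%:E =
   \int[pushforward mu (-%R : _ -> measurableTypeR R)]_(x in A) (normal_pdf 0 1 x)%:E)%E.
  by apply: eq_measure_integral => //= B mB _; exact/esym/lebesgue_measureN.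
rewrite E ge0_integral_pushforward//=; last 2 first.
- exact: measurable_funTS (mpdf 1).
- by move=> x _; rewrite lee_fin normal_pdf_ge0.
apply: eq_integral => x _; congr EFin.
by rewrite !normal_pdfE ?oner_eq0// /normal_fun !subr0 sqrrN.
Qed.

(** The variance of the standard normal law, carried as a symbolic finite constant that ends up in
    [kappaDM]. *)
Definition normal_var : R := fine (\int[nu]_x (x ^+ 2)%:E)%E.

Lemma normal_varE : (\int[nu]_x (x ^+ 2)%:E = normal_var%:E)%E.
Proof.
rewrite fineK// ge0_fin_numE ?normal_second_moment_lty//.
by apply: integral_ge0 => x _; rewrite lee_fin sqr_ge0.
Qed.

Lemma normal_var_ge0 : 0 <= normal_var.
Proof. by apply: fine_ge0; apply: integral_ge0 => x _; rewrite lee_fin sqr_ge0. Qed.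

End StandardNormal.

Section GaussianVector.
Context d (T : measurableType d) (R : realType) (P : probability T R) (p : nat).
Context (g : {RV P >-> p.-tuple R}).
Hypothesis gauss : standard_gaussian P g.
Local Notation nu := (@normal_prob R 0 1).
Local Notation c i := (coordinate g i).

Let mc i : measurable_fun [set: T] (c i).
Proof. by apply: (measurableT_comp (measurable_tnth i)). Qed.

(* [R] and [measurableTypeR R], which carries the normal law, have the same *)
(* measurable sets but different displays.                                  *)
Local Notation GR := (measurableTypeR R).
Let cg (i : 'I_p) : T -> GR := c i.
Let mcg i : measurable_fun [set: T] (cg i). Proof. exact: mc. Qed.

HB.instance Definition _ i := isMeasurableFun.Build _ _ _ _ (cg i) (mcg i).

Lemma gauss_pair_law i j (A B : set R) : i != j -> measurable A -> measurable B ->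
  P (c i @^-1` A `&` c j @^-1` B) = (nu A * nu B)%E.
Proof.
move=> ij mA mB.
pose D k := if k == i then A else if k == j then B else setT.
have mD k : measurable (D k) by rewrite /D; case: ifP => // _; case: ifP.
have := gauss mD.
rewrite (bigD1 i)//= (bigD1 j)//= 1?eq_sym//.
rewrite {2}/D eqxx {2}/D [j == i]eq_sym (negbTE ij) eqxx big1 ?mule1.
  move=> <-; congr (P _); apply/seteqP; split=> w /=.
    by move=> [Aw Bw] k; rewrite /D; case: eqP => [->//|_]; case: eqP => [->|].
  move=> Dw; split; first by have := Dw i; rewrite /D eqxx.
  by have := Dw j; rewrite /D [j == i]eq_sym (negbTE ij) eqxx.
by move=> k /andP[ki kj]; rewrite /D (negbTE ki) (negbTE kj) probability_setT.
Qed.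

Lemma gauss_law i (A : set R) : measurable A -> P (c i @^-1` A) = nu A.
Proof.
move=> mA; pose D k := if k == i then A else setT.
have mD k : measurable (D k) by rewrite /D; case: ifP.
have := gauss mD.
rewrite (bigD1 i)//= {2}/D eqxx big1 ?mule1.
  move=> <-; congr (P _); apply/seteqP; split=> w /=.
    by move=> Aw k; rewrite /D; case: eqP => [->|].
  by move=> /(_ i); rewrite /D eqxx.
by move=> k ki; rewrite /D (negbTE ki) probability_setT.
Qed.

Lemma gauss_sqr i : (\int[P]_w (c i w * c i w)%:E = (normal_var R)%:E)%E.
Proof.
rewrite -normal_varE.
have mX2 : measurable_fun [set: R] (fun x : R => (x ^+ 2)%:E).
  by apply/measurable_EFinP; exact: exprn_measurable.
transitivity (\int[distribution P (cg i)]_x (x ^+ 2)%:E)%E.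
  by rewrite ge0_integral_distribution// => x; rewrite lee_fin sqr_ge0.
by apply: eq_measure_integral => A mA _; exact: gauss_law.
Qed.

Lemma gauss_integrable i j : P.-integrable [set: T] (EFin \o (fun w => c i w * c j w)).
Proof.
have sq k : P.-integrable [set: T] (EFin \o (fun w => c k w * c k w)).
  apply/integrableP; split.
    by apply/measurable_EFinP; exact: measurable_funM.
  under eq_integral do rewrite /= ger0_norm -?expr2 ?sqr_ge0// expr2.
  by rewrite gauss_sqr ltry.
apply: (@le_integrable _ _ _ _ _ _ _
  (fun w => (c i w * c i w)%:E + (c j w * c j w)%:E)%E) => //.
- by apply/measurable_EFinP; exact: measurable_funM.
- move=> w _ /=; rewrite lee_fin.
  have h1 := sqr_ge0 (c i w + c j w); have h2 := sqr_ge0 (c i w - c j w).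
  have h3 := sqr_ge0 (c i w); have h4 := sqr_ge0 (c j w).
  rewrite [leRHS]ger0_norm; last by rewrite -!expr2; lra.
  rewrite ler_norml; move: h1 h2 h3 h4; rewrite !expr2; lra.
- by apply: (integrableD _ (sq i) (sq j)).
Qed.

(* [(c i, c j)] and [(- c i, c j)] have the same law. *)
Lemma gauss_cross i j : i != j -> (\int[P]_w (c i w * c j w)%:E = 0)%E.
Proof.
move=> ij.
pose Z (w : T) : GR * GR := (c i w, c j w); pose Z' (w : T) : GR * GR := (- c i w, c j w).
have mZ : measurable_fun [set: T] Z by apply: (measurable_fun_pair (mcg i) (mcg j)).
have mZ' : measurable_fun [set: T] Z'.
  apply: (measurable_fun_pair _ (mcg j)).
  by have := measurableT_comp (@oppr_measurable R setT) (mc i).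
pose RZ : {RV P >-> (GR * GR)%type} := HB.pack Z (isMeasurableFun.Build _ _ _ _ Z mZ).
pose RZ' : {RV P >-> (GR * GR)%type} := HB.pack Z' (isMeasurableFun.Build _ _ _ _ Z' mZ').
have lawZ (C : set (GR * GR)) : measurable C -> distribution P RZ C = distribution P RZ' C.
  move=> mC; transitivity ((nu \x nu)%E C).
    apply/esym/product_measure_unique => // A B mA mB.
    by rewrite /distribution /pushforward -(gauss_pair_law ij).
  apply/product_measure_unique => // A B mA mB.
  transitivity (nu (-%R @^-1` A) * nu B)%E; last by rewrite normal_probN.
  rewrite -(gauss_pair_law ij)//.
  by rewrite -[X in measurable X]setTI; exact: oppr_measurable.
pose f (z : GR * GR) := ((z.1 : R) * (z.2 : R))%:E.
have mf : measurable_fun [set: GR * GR] f.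
  apply/measurable_EFinP; apply: measurable_funM; first exact: measurable_fst.
  exact: measurable_snd.
have I1 := gauss_integrable i j.
have fE : f \o RZ' = fun w => ((-1)%:E * (EFin \o (fun w => c i w * c j w)%R) w)%E.
  by apply: funext => w; rewrite /f /= -EFinM mulN1r mulNr.
have I2 : P.-integrable [set: T] (f \o RZ') by rewrite fE; exact: integrableZl.
have E : (\int[P]_w (c i w * c j w)%:E = \int[P]_w (f \o RZ') w)%E.
  rewrite -(integral_distribution (X := RZ'))// -[LHS]/(\int[P]_w (f \o RZ) w)%E.
  rewrite -(integral_distribution (X := RZ))//.
  by apply: eq_measure_integral => C mC _; exact: lawZ.
have E2 : (\int[P]_w (f \o RZ') w = (-1)%:E * \int[P]_w (c i w * c j w)%:E)%E.
  by rewrite fE integralZl.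
have fin : (\int[P]_w (c i w * c j w)%:E)%E \is a fin_num by exact: integrable_fin_num.
move: E; rewrite E2 -(fineK fin) -EFinM => -[e].
by congr EFin; lra.
Qed.

(** The coordinates are uncorrelated with common second moment [normal_var], so only the diagonal of
    [S^T *m S] survives. *)
Lemma gauss_norm2_sqr (S : 'M[R]_p) :
  (\int[P]_w (norm2 (S *m vec (g w)) ^+ 2)%:E = (normal_var R * \tr (S^T *m S))%:E)%E.
Proof.
have cm j k : (\int[P]_w (c j w * c k w)%:E = (normal_var R * (j == k)%:R)%:E)%E.
  have [->|jk] := eqVneq j k; first by rewrite gauss_sqr mulr1.
  by rewrite gauss_cross// mulr0.
have := integral_quadratic (fun j k => (S^T *m S) j k) gauss_integrable cm.
have -> : (\sum_j \sum_k (S^T *m S) j k * (normal_var R * (j == k)%:R)) =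
   normal_var R * \tr (S^T *m S).
  rewrite mulr_sumr; apply: eq_bigr => j _.
  rewrite (bigD1 j)//= eqxx big1 ?addr0; first by rewrite mulr1 mulrC.
  by move=> k kj; rewrite eq_sym (negbTE kj) !mulr0.
move=> <-; apply: eq_integral => w _; congr EFin; rewrite norm2_sqr.
transitivity (\sum_i \sum_j \sum_k S i j * S i k * (c j w * c k w)).
  apply: eq_bigr => i _; rewrite mxE expr2 mulr_suml; apply: eq_bigr => j _.
  rewrite mulr_sumr; apply: eq_bigr => k _; rewrite !mxE /coordinate; ring.
rewrite exchange_big /=; apply: eq_bigr => j _.
rewrite exchange_big /=; apply: eq_bigr => k _.
by rewrite mxE mulr_suml; apply: eq_bigr => i _; rewrite mxE.
Qed.

(** Jensen's inequality, obtained by integrating [2 * t * x <= x^2 + t^2] and taking [t] equal to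
    the expectation. *)
Lemma gauss_norm2_le (S : 'M[R]_p) :
  (fine ('E_P[fun w => norm2 (S *m vec (g w))])%E) ^+ 2 <= normal_var R * \tr (S^T *m S).
Proof.
set m := normal_var R * _; rewrite unlock.
have mn : measurable_fun [set: T] (fun w => norm2 (S *m vec (g w))).
  apply: measurable_norm2 => i.
  rewrite (_ : (fun _ => _) = fun w => \sum_j S i j * vec (g w) j 0); last first.
    by apply: funext => w; rewrite mxE.
  apply: measurable_sum => j; apply: measurable_funM; first exact: measurable_cst.
  exact: (mvec_vec (f := g)).
set e := fine _.
have e0 : 0 <= e.
  by apply: fine_ge0; apply: integral_ge0 => w _; rewrite lee_fin norm2_ge0.
have H (t : R) : 0 < t -> 2 * t * e <= m + t ^+ 2.
  move=> t0.
  have : ((2 * t)%:E * \int[P]_w (norm2 (S *m vec (g w)))%:E <= (m + t ^+ 2)%:E)%E.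
    rewrite -ge0_integralZl//; last 3 first.
    - exact/measurable_EFinP.
    - by move=> w _; rewrite lee_fin norm2_ge0.
    - by rewrite lee_fin mulr_ge0// ltW.
    apply: (@le_trans _ _ (\int[P]_w ((norm2 (S *m vec (g w)) ^+ 2)%:E + (t ^+ 2)%:E))%E).
      apply: ge0_le_integral => //.
      - by move=> w _; rewrite -EFinM lee_fin !mulr_ge0 ?norm2_ge0// ltW.
      - by apply: measurable_funeM; exact/measurable_EFinP.
      - by apply: emeasurable_funD => //; apply/measurable_EFinP; exact: measurable_funX.
      - move=> w _; rewrite -EFinM -EFinD lee_fin.
        have := sqr_ge0 (norm2 (S *m vec (g w)) - t); rewrite !expr2; lra.
    rewrite ge0_integralD//; last 3 first.
    - by move=> w _; rewrite lee_fin sqr_ge0.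
    - by apply/measurable_EFinP; exact: measurable_funX.
    - by move=> w _; rewrite lee_fin sqr_ge0.
    by rewrite gauss_norm2_sqr -/m integral_cst//= probability_setT mule1.
  rewrite /e; case E : (\int[P]_w _)%E => [r| |] /=.
  - by rewrite -EFinM lee_fin.
  - by rewrite gt0_muley ?lte_fin ?mulr_gt0// leye_eq.
  - have : (0 <= \int[P]_w (norm2 (S *m vec (g w)))%:E)%E.
      by apply: integral_ge0 => w _; rewrite lee_fin norm2_ge0.
    by rewrite E.
have [e1|e1] := eqVneq e 0.
  rewrite e1 expr0n /= -lee_fin -gauss_norm2_sqr.
  by apply: integral_ge0 => w _; rewrite lee_fin sqr_ge0.
have ep : 0 < e by rewrite lt_neqAle eq_sym e1.
have := H e ep; rewrite expr2; lra.
Qed.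

Lemma dvoretzky_dim_le (G : 'M[R]_p) :
  0 < dvoretzky_dim P g G ->
  0 < opnorm G /\ dvoretzky_dim P g G * opnorm G <= normal_var R * \tr G.
Proof.
rewrite /dvoretzky_dim => d0.
have op0 : 0 < opnorm G.
  rewrite lt_neqAle opnorm_ge0 andbT eq_sym; apply: contraTneq d0 => ->.
  by rewrite invr0 mulr0 ltxx.
split=> //; rewrite divfK ?gt_eqF//.
move: d0; rewrite pmulr_lgt0 ?invr_gt0// /sqrtmx.
(* Either [sqrtmx] returns a symmetric [S] with [S *m S = G], so that [S^T *m S] has the trace of
   [G], or it returns the default 0. The latter gives dimension 0, against the positivity
   assumption. *)
case: xgetP => [S _ [[St _] SS]|_].
  by move=> _; apply: le_trans (gauss_norm2_le S) _; rewrite St SS.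
rewrite unlock; under eq_integral do rewrite mul0mx norm2_0.
by rewrite integral0 /= expr0n ltxx.
Qed.

End GaussianVector.

(** * Measurability of the target event *)

Section RationalDirections.
Context (R : realType).

Lemma norm2D p (u v : 'cV[R]_p) : norm2 (u + v) <= norm2 u + norm2 v.
Proof.
rewrite -ler_sqr ?nnegrE ?addr_ge0 ?norm2_ge0//.
have -> : norm2 (u + v) ^+ 2 = norm2 u ^+ 2 + 2 * dotp u v + norm2 v ^+ 2.
  rewrite !norm2_sqr /dotp mulr_sumr -!big_split /=; apply: eq_bigr => i _.
  by rewrite mxE; ring.
have := le_trans (ler_norm _) (dotp_le u v); rewrite sqrrD mulr2n; lra.
Qed.

Lemma norm2_mulmx_frob m n (M : 'M[R]_(m, n)) (v : 'cV[R]_n) :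
  norm2 (M *m v) <= Num.sqrt (\sum_i \sum_j M i j ^+ 2) * norm2 v.
Proof.
rewrite -(ger0_norm (norm2_ge0 v)) -sqrtr_sqr -sqrtrM; last first.
  by apply: sumr_ge0 => i _; apply: sumr_ge0 => j _; exact: sqr_ge0.
rewrite ler_wsqrtr// mulr_suml; apply: ler_sum => i _; rewrite mxE norm2_sqr.
exact: sum_cauchy_schwarz.
Qed.

Lemma norm2N p (u : 'cV[R]_p) : norm2 (- u) = norm2 u.
Proof. by rewrite /norm2; congr Num.sqrt; apply: eq_bigr => i _; rewrite mxE sqrrN. Qed.

(** Each coordinate is approximated within [e / (n + 1)], and [n / (n + 1)^2 <= 1]. *)
Lemma rational_approx n (v : 'cV[R]_n) (e : R) : 0 < e ->
  exists q : 'cV[rat]_n, norm2 (v - map_mx ratr q) <= e.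
Proof.
move=> e0; pose e' := e / (n%:R + 1).
have n1 : 0 < n%:R + 1 :> R by rewrite ltr_wpDl.
have e'0 : 0 < e' by rewrite divr_gt0.
have H i : exists q : rat, `|v i 0 - ratr q| <= e'.
  have [|q] := @rat_in_itvoo R (v i 0 - e') (v i 0 + e'); first by lra.
  by rewrite in_itv /= => /andP[q1 q2]; exists q; rewrite ler_norml; lra.
have [q qP] := choice H.
exists (\col_i q i); rewrite -ler_sqr ?nnegrE ?norm2_ge0 ?(ltW e0)// norm2_sqr.
apply: (@le_trans _ _ (\sum_(i < n) e' ^+ 2)).
  apply: ler_sum => i _; rewrite !mxE -real_normK ?num_real//.
  by rewrite lerXn2r ?nnegrE ?(ltW e'0).
rewrite sumr_const card_ord -[X in X <= _]mulr_natl /e' expr_div_n mulrCA ler_piMr ?sqr_ge0//.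
rewrite ler_pdivrMr ?exprn_gt0// mul1r.
have := ler0n R n; rewrite expr2; nra.
Qed.

(** Both sides are Lipschitz in the vector, with the Frobenius norms as constants, and rational
    vectors are dense. *)
Lemma norm2_le_of_rational m k n (M : 'M[R]_(m, n)) (M' : 'M[R]_(k, n)) :
  (forall q : 'cV[rat]_n, norm2 (M *m map_mx ratr q) <= norm2 (M' *m map_mx ratr q)) ->
  forall v, norm2 (M *m v) <= norm2 (M' *m v).
Proof.
move=> H v; apply/ler_addgt0Pr => e e0.
set C := Num.sqrt (\sum_i \sum_j M i j ^+ 2).
set C' := Num.sqrt (\sum_i \sum_j M' i j ^+ 2).
have C0 : 0 <= C by exact: sqrtr_ge0.
have C'0 : 0 <= C' by exact: sqrtr_ge0.
have CC : 0 < C + C' + 1 by lra.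
have e1 : 0 < e / (C + C' + 1) by rewrite divr_gt0.
have [q] := rational_approx v e1; set u := map_mx ratr q => qv.
have E1 : norm2 (M *m v) <= norm2 (M *m u) + C * norm2 (v - u).
  have -> : M *m v = M *m u + M *m (v - u) by rewrite -mulmxDr subrKC.
  by apply: le_trans (norm2D _ _) _; rewrite lerD2l; exact: norm2_mulmx_frob.
have E2 : norm2 (M' *m u) <= norm2 (M' *m v) + C' * norm2 (v - u).
  have -> : M' *m u = M' *m v + M' *m (- (v - u)) by rewrite -mulmxDr opprB subrKC.
  apply: le_trans (norm2D _ _) _; rewrite lerD2l -(norm2N (v - u)).
  exact: norm2_mulmx_frob.
have E3 : (C + C') * norm2 (v - u) <= e.
  apply: (@le_trans _ _ ((C + C' + 1) * (e / (C + C' + 1)))).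
    by apply: ler_pM => //; rewrite ?norm2_ge0 ?addr_ge0// lerDl.
  by rewrite mulrCA divff ?mulr1// gt_eqF.
have := H q; rewrite -/u; lra.
Qed.

End RationalDirections.

Section IsometryEvent.
Context d (T : measurableType d) (R : realType) (P : probability T R) (p N : nat).
Context (X : 'I_N -> {RV P >-> p.-tuple R}).

(** The quantifier over real vectors is replaced by a countable intersection over rational ones.
    Writing [a * norm2 lambda] as the norm of [a%:M *m lambda] lets one density lemma serve both
    inequalities. *)
Lemma measurable_isometry_event (a b : R) : 0 <= a -> 0 <= b ->
  measurable [set w | forall lambda : 'cV[R]_N,
     a * norm2 lambda <= norm2 (random_matrix X w *m lambda) /\
     norm2 (random_matrix X w *m lambda) <= b * norm2 lambda].
Proof.
move=> a0 b0.
pose E (q : 'cV[rat]_N) : set T :=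
  [set w | a * norm2 (map_mx ratr q : 'cV[R]_N) <= norm2 (random_matrix X w *m map_mx ratr q)] `&`
  [set w | norm2 (random_matrix X w *m map_mx ratr q) <= b * norm2 (map_mx ratr q : 'cV[R]_N)].
have mE q : measurable (E q).
  have mv : mvec (fun w => random_matrix X w *m map_mx ratr q).
    move=> i; rewrite (_ : (fun _ => _) =
        fun w => \sum_j vec (X j w) i 0 * (map_mx ratr q : 'cV[R]_N) j 0); last first.
      apply: funext => w; rewrite mxE; apply: eq_bigr => j _.
      by rewrite !mxE.
    apply: measurable_sum => j; apply: measurable_funM; last exact: measurable_cst.
    exact: (mvec_vec (f := X j)).
  apply: measurableI; apply: measurable_ler_set => //; exact: measurable_norm2.
pose F (n : nat) : set T := if unpickle n is Some q then E q else setT.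
rewrite (_ : [set w | _] = \bigcap_n (F n)).
  by apply: bigcapT_measurable => n; rewrite /F; case: unpickle.
apply/seteqP; split=> w /=.
  by move=> H n _; rewrite /F; case: unpickle => // q; split; case: (H (map_mx ratr q)).
move=> H lambda.
have Hq (q : 'cV[rat]_N) : E q w by have := H (pickle q) I; rewrite /F pickleK.
split.
  have := @norm2_le_of_rational R _ _ _ (a%:M : 'M[R]_N) (random_matrix X w) _ lambda.
  rewrite mul_scalar_mx norm2Z ger0_norm//; apply=> q.
  by rewrite mul_scalar_mx norm2Z ger0_norm//; case: (Hq q).
have := @norm2_le_of_rational R _ _ _ (random_matrix X w) (b%:M : 'M[R]_N) _ lambda.
rewrite mul_scalar_mx norm2Z ger0_norm//; apply=> q.
by rewrite mul_scalar_mx norm2Z ger0_norm//; case: (Hq q).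
Qed.

End IsometryEvent.

(** * The exceptional events *)

Section Events.
Context d (T : measurableType d) (R : realType) (P : probability T R) (p N : nat).
Context (X : 'I_N -> {RV P >-> p.-tuple R}).
Hypothesis indX : independent_rvs P X.
Hypothesis N_gt0 : (0 < N)%N.
Context (sigma : R).

Lemma union_bound (I : finType) (Q : pred I) (A : I -> set T) :
  (forall i, Q i -> measurable (A i)) ->
  measurable (\big[setU/set0]_(i | Q i) A i) /\
  (P (\big[setU/set0]_(i | Q i) A i) <= \sum_(i | Q i) P (A i))%E.
Proof.
move=> mA.
apply: (big_ind2 (fun B s => measurable B /\ (P B <= s)%E)) => //.
- by rewrite measure0.
- move=> B1 s1 B2 s2 [mB1 B1s] [mB2 B2s]; split; first exact: measurableU.
  by apply: le_trans (measureU2 _ _ _) _ => //; exact: leeD.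
- by move=> i Qi; split=> //; exact: mA.
Qed.

Lemma notin_bigU (I : finType) (Q : pred I) (A : I -> set T) (w : T) (i : I) :
  ~ (\big[setU/set0]_(i | Q i) A i) w -> Q i -> ~ A i w.
Proof. by move=> H Qi Ai; apply: H; rewrite (bigD1 i)//=; left. Qed.

Let xs (w : T) : 'I_N -> p.-tuple R := fun j => X j w.
Let exceed (t : R) (v : 'I_N -> R) (K : {set 'I_N}) : set T :=
  [set w | forall i, i \in K ->
     t * sigma * norm2 (comb (xs w) v) < `|dotp (vec (xs w i)) (comb (xs w) v)|].

Let measurable_exceed t v K : measurable (exceed t v K).
Proof.
apply: (measurable_finI (Q := fun i => i \in K)) => i _.
have mv : mvec (fun w => comb (xs w) v) by apply: mvec_comb => j.
apply: measurable_ltr_set.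
  by apply: measurable_funM; [exact: measurable_cst|exact: measurable_norm2].
apply: measurableT_comp => //; apply: measurable_dotp => //.
exact: (mvec_vec (f := X i)).
Qed.

(** A union bound over nonempty [K] and codes of prefixes vanishing on [K], each event being
    estimated by [large_together]. *)
Lemma large_event (S D : nat) (Cq : R) :
  (4 ^ S <= 4 * N)%N -> 0 < Cq ->
  (forall i y t, 0 < t -> (P (X i @^-1`
     [set x | (t * sigma * norm2 y < `|dotp (vec x) y|)%R]) <=
     ((Cq / t) ^+ (4 * (2 * D + 2)))%:E)%E) ->
  exists Bad : set T, [/\ measurable Bad, (P Bad <= (N%:R^-1)%:E)%E &
    forall w, ~ Bad w -> forall (K : {set 'I_N}) (v : 'I_N -> R),
      K != finset.set0 -> (forall i, i \in K -> v i = 0) -> nsq v <= 2 -> dyadic S v ->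
      (#|[set i | (v i != 0)%R]%SET| <= D * #|K|)%N ->
      exists2 i, i \in K & `|dotp (vec (xs w i)) (comb (xs w) v)| <=
         4 * expR 15 * Cq * root4 (N%:R / #|K|%:R) * (sigma * norm2 (comb (xs w) v))].
Proof.
move=> SN Cq0 tail.
have Nr : 0 < N%:R :> R by rewrite ltr0n.
pose C1 : R := 4 * expR 15 * Cq.
have C10 : 0 < C1 by rewrite !mulr_gt0 ?expR_gt0.
pose thr (K : {set 'I_N}) : R := C1 * root4 (N%:R / #|K|%:R).
pose rho : R := (Cq / C1) ^+ (4 * (2 * D + 2)).
have ratio : Cq / C1 = expR (- 15) / 4.
  by rewrite /C1 expRN; field; rewrite !gt_eqF ?expR_gt0.
have e1 : expR (- 15) <= 1 :> R by rewrite expR_le1; lra.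
have e0 : 0 < expR (- 15) :> R by exact: expR_gt0.
have rho0 : 0 <= rho by rewrite exprn_ge0// ratio; lra.
have rho1 : rho <= expR (- 15) / 4.
  rewrite /rho ratio -[leRHS]expr1; apply: ler_wiXn2l; [lra|lra|lia].
pose ok (K : {set 'I_N}) (c : sign_code N S) : bool :=
  [forall i in K, code_val R c i == 0] && ((nsq (code_val R c) <= 2) &&
       (#|[set i | (code_val R c i != 0)%R]%SET| <= D * #|K|)%N).
pose A (K : {set 'I_N}) (c : sign_code N S) := exceed (thr K) (code_val R c) K.
have PA (K : {set 'I_N}) c : K != finset.set0 -> ok K c ->
  (P (A K c) <= ((rho * (#|K|%:R / N%:R) ^+ (2 * D + 2)) ^+ #|K|)%R%:E)%E.
  move=> K0 /andP[/'forall_implyP cK _].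
  have kr : 0 < #|K|%:R :> R by rewrite ltr0n card_gt0.
  have r0 : 0 < root4 (N%:R / #|K|%:R : R) by rewrite root4_gt0// divr_gt0.
  have t0 : 0 < thr K by rewrite mulr_gt0.
  (* The moment order is a multiple of 4, so the fourth root in the threshold becomes the power
     [2 * D + 2] of [#|K| / N] expected by [union_bound_sum]. *)
  have cE : (Cq / thr K) ^+ (4 * (2 * D + 2)) = rho * (#|K|%:R / N%:R) ^+ (2 * D + 2).
    rewrite /thr invfM mulrA exprMn -/rho; congr (_ * _).
    by rewrite exprVn exprM pow_root4 ?divr_ge0// -exprVn invf_div.
  rewrite -cE; apply: (large_together indX (s := thr K * sigma)).
    by move=> i y; exact: tail.
  by move=> i iK; apply/eqP; exact: cK.
pose BadK (K : {set 'I_N}) := \big[setU/set0]_(c : sign_code N S | ok K c) A K c.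
pose Bad := \big[setU/set0]_(K : {set 'I_N} | K != finset.set0) BadK K.
have mBK K : measurable (BadK K).
  by apply: (union_bound _).1 => c _; exact: measurable_exceed.
have [mBad PBad] := @union_bound _ (fun K : {set 'I_N} => K != finset.set0) BadK (fun K _ => mBK K).
exists Bad; split=> //.
  apply: le_trans PBad _.
  have SU := union_bound_sum D N_gt0 SN rho0 rho1.
  apply: (@le_trans _ _ (\sum_(K : {set 'I_N} | K != finset.set0)
    \sum_(c : sign_code N S | (nsq (code_val R c) <= 2)%R &&
       (#|[set i | (code_val R c i != 0)%R]%SET| <= D * #|K|)%N)
      ((rho * (#|K|%:R / N%:R) ^+ (2 * D + 2)) ^+ #|K|)%R%:E)%E).
    apply: lee_sum => K K0.
    apply: le_trans (union_bound (fun c (_ : ok K c) => measurable_exceed _ _ _)).2 _.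
    apply: (@le_trans _ _ (\sum_(c : sign_code N S | ok K c)
       ((rho * (#|K|%:R / N%:R) ^+ (2 * D + 2)) ^+ #|K|)%R%:E)%E).
      by apply: lee_sum => c cok; exact: PA.
    rewrite !sumEFin lee_fin big_mkcond [leRHS]big_mkcond /=; apply: ler_sum => c _.
    have g0 : 0 <= (rho * (#|K|%:R / N%:R) ^+ (2 * D + 2)) ^+ #|K|.
      by rewrite exprn_ge0// mulr_ge0// exprn_ge0// divr_ge0.
    rewrite /ok; case: [forall i in K, _] => /=; last by case: ifP.
    by [].
  by under eq_bigr do rewrite sumEFin; rewrite sumEFin lee_fin.
move=> w nBad K v K0 vK v2 dv vD.
have [c vc] := dyadic_code dv.
have cok : ok K c.
  apply/andP; split; last by rewrite -vc v2.
  by apply/'forall_implyP => i iK; rewrite -vc vK.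
have nA := notin_bigU (notin_bigU nBad K0) cok.
apply: contrapT => nex; apply: nA => i iK; rewrite -vc ltNge; apply/negP => le1.
by apply: nex; exists i => //; rewrite /thr mulrA in le1 *.
Qed.

(** Chebyshev's inequality at the level [N^(3/2)] gives probability at most [N^-3] for each of at
    most [N^2] pairs. A pair is the case of [large_together] with [K] a singleton and [v] a basis
    vector. *)
Lemma small_event :
  (forall i y t, 0 < t -> (P (X i @^-1`
     [set x | (t * sigma * norm2 y < `|dotp (vec x) y|)%R]) <= ((1 / t) ^+ 2)%:E)%E) ->
  exists Bad : set T, [/\ measurable Bad, (P Bad <= (N%:R^-1)%:E)%E &
    forall w, ~ Bad w -> forall i j, i != j ->
      `|dotp (vec (xs w i)) (vec (xs w j))| <=
         Num.sqrt (N%:R ^+ 3) * sigma * norm2 (vec (xs w j))].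
Proof.
move=> tail.
have Nr : 0 < N%:R :> R by rewrite ltr0n.
pose t : R := Num.sqrt (N%:R ^+ 3).
have t0 : 0 < t by rewrite sqrtr_gt0 exprn_gt0.
pose e j : 'I_N -> R := fun k => (k == j)%:R.
have combe w j : comb (xs w) (e j) = vec (xs w j).
  rewrite /comb (bigD1 j)//= /e eqxx scale1r big1 ?addr0// => k kj.
  by rewrite (negbTE kj) scale0r.
pose A (ij : 'I_N * 'I_N) := exceed t (e ij.2) [set ij.1]%SET.
pose Q (ij : 'I_N * 'I_N) := ij.1 != ij.2.
have [mBad PBad] := @union_bound _ Q A (fun ij _ => measurable_exceed _ _ _).
exists (\big[setU/set0]_(ij | Q ij) A ij); split=> //.
  apply: le_trans PBad _.
  apply: (@le_trans _ _ (\sum_(ij : 'I_N * 'I_N | Q ij) ((N%:R ^+ 3)^-1)%R%:E)%E).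
    apply: lee_sum => -[i j] ij.
    have -> : (N%:R ^+ 3)^-1 = ((1 / t) ^+ 2) ^+ #|[set i]%SET| :> R.
      by rewrite cards1 expr1 div1r exprVn sqr_sqrtr// exprn_ge0.
    apply: (large_together indX (s := t * sigma)).
      by move=> k y; exact: tail.
    by move=> k; rewrite inE => /eqP->; rewrite /e (negbTE ij).
  rewrite sumEFin lee_fin sumr_const -[X in X <= _]mulr_natl.
  have : #|[pred ij | Q ij]|%:R <= N%:R ^+ 2 :> R.
    rewrite -natrX ler_nat; apply: leq_trans (max_card _) _.
    by rewrite card_prod !card_ord.
  have i0 : 0 <= (N%:R ^+ 3)^-1 :> R by rewrite invr_ge0 exprn_ge0.
  move=> /(ler_wpM2r i0) /le_trans; apply.
  by rewrite le_eqVlt; apply/orP; left; apply/eqP; field; rewrite gt_eqF.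
move=> w nBad i j ij.
have nA := notin_bigU nBad (ij : Q (i, j)).
rewrite leNgt; apply/negP => lt1; apply: nA => k; rewrite inE => /eqP->.
by rewrite /= combe.
Qed.

End Events.

(** * From the Gram matrix to the near isometry *)

Section NearIsometry.
Context (R : realType) (p N : nat) (x : 'I_N -> p.-tuple R).

Definition offdiag_gram (i j : 'I_N) : R :=
  if i == j then 0 else dotp (vec (x i)) (vec (x j)).

Local Notation G := offdiag_gram.
Local Notation sqn i := (norm2 (vec (x i)) ^+ 2).

Lemma dotpC (u v : 'cV[R]_p) : dotp u v = dotp v u.
Proof. by apply: eq_bigr => i _; rewrite mulrC. Qed.

Lemma dotp_combr (u : 'cV[R]_p) (v : 'I_N -> R) :
  dotp u (comb x v) = \sum_j dotp u (vec (x j)) * v j.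
Proof.
rewrite /dotp; under eq_bigr do rewrite /comb summxE mulr_sumr.
rewrite exchange_big /=; apply: eq_bigr => j _.
by rewrite mulr_suml; apply: eq_bigr => i _; rewrite mxE; ring.
Qed.

Lemma dotp_comb (u v : 'I_N -> R) :
  dotp (comb x u) (comb x v) = bil G u v + \sum_i u i * v i * sqn i.
Proof.
rewrite dotpC dotp_combr -big_split /=; apply: eq_bigr => i _.
rewrite dotpC dotp_combr mulr_suml (bigD1 i)//= dotp_self addrC.
rewrite [in RHS](bigD1 i)//= {1}/G eqxx mulr0 mul0r add0r; congr (_ + _); last by ring.
by apply: eq_bigr => j ji; rewrite /G eq_sym (negbTE ji); ring.
Qed.

Lemma norm2_comb_sqr (v : 'I_N -> R) :
  norm2 (comb x v) ^+ 2 = bil G v v + \sum_i v i ^+ 2 * sqn i.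
Proof. by rewrite -dotp_self dotp_comb. Qed.

Lemma nsq_ge0 (v : 'I_N -> R) : 0 <= nsq v.
Proof. by apply: sumr_ge0 => i _; exact: sqr_ge0. Qed.

Lemma bilZ (a : R) (v : 'I_N -> R) :
  bil G (fun i => a * v i) (fun i => a * v i) = a ^+ 2 * bil G v v.
Proof.
rewrite /bil mulr_sumr; apply: eq_bigr => i _.
by rewrite mulr_sumr; apply: eq_bigr => j _; ring.
Qed.

Lemma nsqZ (a : R) (v : 'I_N -> R) : nsq (fun i => a * v i) = a ^+ 2 * nsq v.
Proof. by rewrite /nsq mulr_sumr; apply: eq_bigr => i _; rewrite exprMn. Qed.

Context (m : R).
Hypothesis x_le : forall i, sqn i <= m.

Lemma bil_le_norm (c : R) (v : 'I_N -> R) :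
  (forall u, nsq u <= 1 -> `|bil G u u| <= c) -> `|bil G v v| <= c * nsq v.
Proof.
move=> H; have [v0|v0] := eqVneq (nsq v) 0.
  have vi i : v i = 0.
    apply/eqP; rewrite -sqrf_eq0 eq_le sqr_ge0 andbT -v0 /nsq (bigD1 i)//= lerDl.
    by apply: sumr_ge0 => j _; exact: sqr_ge0.
  rewrite v0 mulr0 /bil big1 ?normr0// => i _; rewrite big1// => j _.
  by rewrite vi !mul0r.
have vp : 0 < nsq v by rewrite lt_neqAle eq_sym v0 nsq_ge0.
pose a : R := (Num.sqrt (nsq v))^-1.
have a2 : a ^+ 2 = (nsq v)^-1 by rewrite exprVn sqr_sqrtr// nsq_ge0.
have := H (fun i => a * v i); rewrite bilZ nsqZ a2 mulVf// lexx => /(_ isT).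
by rewrite normrM ger0_norm ?invr_ge0 ?nsq_ge0// mulrC ler_pdivrMr.
Qed.

(* The bound holds for [B = m + sup |bil G u u|], hence bounds this supremum by itself. *)
Lemma offdiag_apriori (th : R) : 0 <= th -> th < 1 -> 0 <= m ->
  (forall B, m <= B -> (forall v, norm2 (comb x v) ^+ 2 <= B * nsq v) ->
     forall v, nsq v <= 1 -> `|bil G v v| <= th * B) ->
  forall v, `|bil G v v| <= th / (1 - th) * m * nsq v.
Proof.
move=> th0 th1 m0 H.
pose V : set R := [set r | exists2 v : 'I_N -> R, nsq v <= 1 & r = `|bil G v v|]%classic.
have V0 : V 0.
  exists (fun=> 0); first by rewrite /nsq big1// => i _; rewrite expr0n.
  by rewrite /bil big1 ?normr0// => i _; rewrite big1// => j _; rewrite !mul0r.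
have Vub : has_ubound V.
  exists (\sum_i \sum_j `|G i j|) => _ [v v1 ->].
  have vi i : `|v i| <= 1.
    rewrite -[leRHS]ger0_norm// -ler_sqr ?nnegrE// !real_normK ?num_real// expr1n.
    apply: le_trans v1; rewrite /nsq (bigD1 i)//= lerDl.
    by apply: sumr_ge0 => j _; exact: sqr_ge0.
  apply: le_trans (ler_norm_sum _ _ _) _; apply: ler_sum => i _.
  apply: le_trans (ler_norm_sum _ _ _) _; apply: ler_sum => j _.
  rewrite !normrM -[leRHS]mulr1; apply: ler_pM => //.
  by rewrite -[leRHS]mul1r; exact: ler_wpM2r.
have hle v : nsq v <= 1 -> `|bil G v v| <= sup V.
  by move=> v1; apply: ub_le_sup => //; exists v.
have h0 : 0 <= sup V by exact: ub_le_sup.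
pose B := m + sup V.
have HB v : norm2 (comb x v) ^+ 2 <= B * nsq v.
  rewrite norm2_comb_sqr /B mulrDl addrC; apply: lerD.
    rewrite /nsq mulr_sumr; apply: ler_sum => i _.
    by rewrite mulrC ler_wpM2r ?sqr_ge0.
  by apply: le_trans (ler_norm _) _; exact: bil_le_norm.
have mB : m <= B by rewrite lerDl.
have supB : sup V <= th * B.
  by apply: ge_sup; [exists 0|move=> _ [v v1 ->]; exact: H mB HB v v1].
have sup2 : sup V <= th / (1 - th) * m.
  rewrite mulrAC ler_pdivlMr ?subr_gt0//; move: supB; rewrite /B; lra.
move=> v; apply: le_trans (bil_le_norm v hle) _.
by rewrite ler_wpM2r ?nsq_ge0.
Qed.

(** The form is the inner product of [comb x u] and [comb x v] minus its diagonal part. The weighted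
    inequality between arithmetic and geometric means bounds each by half of the right-hand side. *)
Lemma bil_offdiag_le (B : R) (k : nat) (u v : 'I_N -> R) : (0 < k)%N -> m <= B ->
  (forall w, norm2 (comb x w) ^+ 2 <= B * nsq w) ->
  `|bil G u v| <= B * (k%:R * nsq u + k%:R^-1 * nsq v).
Proof.
move=> k0 mB HB.
have kr : 0 < k%:R :> R by rewrite ltr0n.
have amgm (a b : R) : `|a * b| <= 2^-1 * (k%:R * a ^+ 2 + k%:R^-1 * b ^+ 2).
  have E : k%:R * a ^+ 2 + k%:R^-1 * b ^+ 2 =
     k%:R^-1 * ((k%:R * a) ^+ 2 + b ^+ 2) by field; rewrite gt_eqF.
  rewrite E [leRHS]mulrCA [leRHS]mulrC ler_pdivlMr// -{1}(ger0_norm (ltW kr)) -normrM.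
  have h1 := sqr_ge0 (k%:R * a + b); have h2 := sqr_ge0 (k%:R * a - b).
  by rewrite ler_norml; move: h1 h2; rewrite !expr2; lra.
have -> : bil G u v = dotp (comb x u) (comb x v) - \sum_i u i * v i * sqn i.
  by rewrite dotp_comb addrK.
apply: le_trans (ler_normB _ _) _.
have ki : 0 < k%:R^-1 :> R by rewrite invr_gt0.
have A1 : `|dotp (comb x u) (comb x v)| <= 2^-1 * (B * (k%:R * nsq u + k%:R^-1 * nsq v)).
  apply: le_trans (dotp_le _ _) _; apply: le_trans (ler_norm _) _.
  apply: le_trans (amgm _ _) _; rewrite ler_wpM2l ?invr_ge0//.
  have := ler_wpM2l (ltW kr) (HB u); have := ler_wpM2l (ltW ki) (HB v); lra.
have A2 : `|\sum_i u i * v i * sqn i| <= 2^-1 * (B * (k%:R * nsq u + k%:R^-1 * nsq v)).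
  apply: le_trans (ler_norm_sum _ _ _) _.
  apply: (@le_trans _ _ (\sum_i 2^-1 * B * (k%:R * u i ^+ 2 + k%:R^-1 * v i ^+ 2))); last first.
    by rewrite -mulr_sumr big_split /= -!mulr_sumr mulrA.
  apply: ler_sum => i _; rewrite normrM (ger0_norm (sqr_ge0 _)).
  rewrite [leRHS]mulrAC; apply: ler_pM => //; first exact: sqr_ge0.
  exact: le_trans (x_le i) mB.
lra.
Qed.

Lemma large_offdiag (S d : nat) (C sigma ell kappa delta : R) :
  (0 < N)%N -> (0 < S)%N -> (N <= 4 ^ S)%N -> (4 ^ S <= 4 * N)%N -> (0 < d)%N ->
  0 <= C -> 0 <= sigma -> 0 <= ell -> 0 <= kappa -> 0 < delta -> delta < 1/2 ->
  m = 3/2 * ell ^+ 2 -> N%:R * sigma ^+ 2 <= kappa * ell ^+ 2 ->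
  60 * (8 * 8) * C * Num.sqrt d%:R * Num.sqrt kappa <= delta / 8 -> 16 * 16 / d%:R <= delta / 8 ->
  (forall (K : {set 'I_N}) (v : 'I_N -> R),
      K != finset.set0 -> (forall i, i \in K -> v i = 0) -> nsq v <= 2 -> dyadic S v ->
      (#|[set i | (v i != 0)%R]%SET| <= d ^ 2 * #|K|)%N ->
      exists2 i, i \in K & `|dotp (vec (x i)) (comb x v)| <=
         C * root4 (N%:R / #|K|%:R) * (sigma * norm2 (comb x v))) ->
  forall v, `|bil G v v| <= delta / 2 * ell ^+ 2 * nsq v.
Proof.
move=> N0 S0 NS SN d0 C0 s0 l0 k0 dl0 dl1 mE Ns Ck dk few v.
have l2 : 0 <= ell ^+ 2 by exact: sqr_ge0.
have m0 : 0 <= m by rewrite mE; lra.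
have th0 : 0 <= delta / 4 by lra.
have th1 : delta / 4 < 1 by lra.
(* With [th = delta / 4] and [m = 3/2 * ell^2] the self-bounding argument gives [delta / 2 * ell^2],
   because [delta <= 1]. *)
apply: (@le_trans _ _ (delta / 4 / (1 - delta / 4) * m * nsq v)); last first.
  rewrite ler_wpM2r ?nsq_ge0// mE mulrA ler_wpM2r//.
  rewrite mulrAC ler_pdivrMr ?subr_gt0//; nra.
apply: (offdiag_apriori th0 th1 m0) => B mB HB {}v v1.
have B0 : 0 <= B by exact: le_trans mB.
have lB : ell ^+ 2 <= B by apply: le_trans mB; rewrite mE; lra.
pose M := sigma * Num.sqrt (2 * B).
pose F (v : 'I_N -> R) := sigma * norm2 (comb x v).
have Gs i j : G i j = G j i by rewrite /G eq_sym dotpC.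
have Gd i : G i i = 0 by rewrite /G eqxx.
have F0 u : 0 <= F u by rewrite mulr_ge0 ?norm2_ge0.
have FM u : nsq u <= 2 -> F u <= M.
  move=> u2; rewrite ler_wpM2l// -(ger0_norm (norm2_ge0 _)) -sqrtr_sqr ler_wsqrtr//.
  by apply: le_trans (HB u) _; rewrite mulrC ler_wpM2r.
have few' (K : {set 'I_N}) (u : 'I_N -> R) :
      K != finset.set0 -> (forall i, i \in K -> u i = 0) -> nsq u <= 2 -> dyadic S u ->
      (#|[set i | (u i != 0)%R]%SET| <= d ^ 2 * #|K|)%N ->
      exists2 i, i \in K & `|\sum_j G i j * u j| <=
         C * root4 (N%:R / #|K|%:R) * F u.
  move=> K0 uK u2 du uD; have [i iK le1] := few K u K0 uK u2 du uD.
  exists i => //; apply: le_trans le1; rewrite dotp_combr le_eqVlt; apply/orP; left.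
  apply/eqP; congr `|_|; apply: eq_bigr => j _; rewrite /G; case: eqP => // <-.
  by rewrite uK// !mulr0.
have half : nsq (fun i => 2^-1 * v i) <= 4^-1.
  rewrite nsqZ expr2; lra.
have := offdiag_form_bound S0 NS SN d0 B0 C0 Gs Gd
   (fun u w => bil_offdiag_le u w d0 mB HB) F0 FM few' half.
rewrite bilZ normrM ger0_norm ?sqr_ge0// => E.
(* Here the bound on [N] enters: [sqrt N * sigma <= sqrt kappa * ell], and [ell^2 <= B]. *)
have key : Num.sqrt N%:R * M <= Num.sqrt kappa * (2 * B).
  rewrite /M mulrA.
  have E1 : Num.sqrt N%:R * sigma <= Num.sqrt kappa * ell.
    rewrite -(ger0_norm s0) -sqrtr_sqr -(ger0_norm l0) -sqrtr_sqr -!sqrtrM//.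
    by rewrite ler_wsqrtr.
  have E2 : ell * Num.sqrt (2 * B) <= 2 * B.
    rewrite -(ger0_norm l0) -sqrtr_sqr -sqrtrM//.
    rewrite -[leRHS]ger0_norm ?mulr_ge0// -sqrtr_sqr ler_wsqrtr//.
    by rewrite expr2; apply: ler_wpM2r; [rewrite mulr_ge0|lra].
  apply: (@le_trans _ _ (Num.sqrt kappa * ell * Num.sqrt (2 * B))).
    by rewrite ler_wpM2r ?sqrtr_ge0.
  by rewrite -mulrA ler_wpM2l ?sqrtr_ge0.
have cd : 0 <= C * Num.sqrt d%:R by rewrite mulr_ge0 ?sqrtr_ge0.
have {}key := ler_wpM2l cd key.
have Ck' := ler_wpM2r B0 Ck; have dk' := ler_wpM2r B0 dk.
have P : C * M * (Num.sqrt N%:R * Num.sqrt d%:R) <=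
    C * Num.sqrt d%:R * (Num.sqrt kappa * (2 * B)).
  by apply: le_trans key; rewrite le_eqVlt; apply/orP; left; apply/eqP; ring.
move: E Ck' dk' P; rewrite expr2.
set u1 := `|_|; set u2 := C * M * _; set u3 := C * Num.sqrt d%:R * _.
have -> : 60 * (8 * 8) * C * Num.sqrt d%:R * Num.sqrt kappa * B = 60 * 32 * u3 by rewrite /u3; ring.
have -> : 60 * C * M * (Num.sqrt N%:R * Num.sqrt d%:R) = 60 * u2 by rewrite /u2; ring.
have -> : 8 * B / d%:R = 8 * (B / d%:R) by ring.
have -> : 16 * 16 / d%:R * B = 16 * 16 * (B / d%:R) by ring.
lra.
Qed.

(** Every entry is at most [a = delta * ell^2 / (2 * N)], and a matrix with such entries has a form
    bounded by [N * a * nsq v]. *)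
Lemma small_offdiag (sigma ell kappa delta : R) :
  (0 < N)%N -> 0 <= sigma -> 0 <= delta ->
  m = 3/2 * ell ^+ 2 -> N%:R * sigma ^+ 2 <= kappa * ell ^+ 2 ->
  6 * kappa * N%:R ^+ 4 <= delta ^+ 2 ->
  (forall i j, i != j -> `|dotp (vec (x i)) (vec (x j))| <=
         Num.sqrt (N%:R ^+ 3) * sigma * norm2 (vec (x j))) ->
  forall v, `|bil G v v| <= delta / 2 * ell ^+ 2 * nsq v.
Proof.
move=> N0 s0 dl0 mE Ns kN few v.
have Nr : 0 < N%:R :> R by rewrite ltr0n.
pose a := delta / 2 * ell ^+ 2 / N%:R.
have a0 : 0 <= a by apply: divr_ge0 => //; apply: mulr_ge0; [exact: divr_ge0|exact: sqr_ge0].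
have Ga i j : `|G i j| <= a.
  rewrite /G; have [_|ij] := eqVneq i j; first by rewrite normr0.
  apply: le_trans (few i j ij) _.
  have q0 : 0 <= Num.sqrt (N%:R ^+ 3) * sigma * norm2 (vec (x j)).
    by rewrite !mulr_ge0 ?sqrtr_ge0 ?norm2_ge0.
  rewrite -ler_sqr ?nnegrE// !exprMn sqr_sqrtr ?exprn_ge0//.
  have A1 : N%:R ^+ 3 * sigma ^+ 2 * sqn j <= N%:R ^+ 3 * sigma ^+ 2 * (3/2 * ell ^+ 2).
    by rewrite ler_wpM2l ?mulr_ge0 ?exprn_ge0// -mE.
  apply: le_trans A1 _.
  have l2 : 0 <= 3/2 * ell ^+ 2 * N%:R ^+ 2 by apply: mulr_ge0; [apply: mulr_ge0; [exact: divr_ge0|exact: sqr_ge0]|exact: sqr_ge0].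
  have A2 := ler_wpM2l l2 Ns.
  have l4 : 0 <= (ell ^+ 2) ^+ 2 / (4 * N%:R ^+ 2).
    by rewrite divr_ge0 ?sqr_ge0// mulr_ge0// sqr_ge0.
  have A3 := ler_wpM2l l4 kN.
  apply: (@le_trans _ _ (3/2 * ell ^+ 2 * N%:R ^+ 2 * (kappa * ell ^+ 2))).
    by apply: le_trans A2; rewrite le_eqVlt; apply/orP; left; apply/eqP; ring.
  rewrite (_ : 3/2 * ell ^+ 2 * N%:R ^+ 2 * (kappa * ell ^+ 2) =
      (ell ^+ 2) ^+ 2 / (4 * N%:R ^+ 2) * (6 * kappa * N%:R ^+ 4)); last first.
    by field; rewrite gt_eqF.
  apply: le_trans A3 _; rewrite le_eqVlt; apply/orP; left; apply/eqP.
  by field; rewrite gt_eqF.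
apply: (@le_trans _ _ (\sum_i \sum_j 2^-1 * a * (v i ^+ 2 + v j ^+ 2))).
  apply: le_trans (ler_norm_sum _ _ _) _; apply: ler_sum => i _.
  apply: le_trans (ler_norm_sum _ _ _) _; apply: ler_sum => j _.
  rewrite mulrAC normrM mulrC -mulrA mulrCA; apply: ler_pM => //.
  have h1 := sqr_ge0 (v i + v j); have h2 := sqr_ge0 (v i - v j).
  by rewrite ler_norml; move: h1 h2; rewrite !expr2; lra.
have -> : \sum_i \sum_j 2^-1 * a * (v i ^+ 2 + v j ^+ 2) = N%:R * a * nsq v.
  under eq_bigr do rewrite -mulr_sumr big_split /= sumr_const card_ord -/(nsq v).
  rewrite -mulr_sumr big_split /= sumr_const card_ord sumrMnl -/(nsq v).
  rewrite -[nsq v *+ N]mulr_natl; by field.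
by rewrite /a mulrC le_eqVlt; apply/orP; left; apply/eqP; field; rewrite gt_eqF.
Qed.

End NearIsometry.

(** The squared ratio lies between [1 - 3/2 * delta] and [1 + 3/2 * delta]; for [delta < 1/2] this
    interval is inside the one from [(1 - 2 * delta)^2] to [(1 + 2 * delta)^2]. *)
Lemma near_isometry (R : realType) (p N : nat) (x : 'I_N -> p.-tuple R) (ell delta : R) :
  0 < ell -> 0 < delta -> delta < 1/2 ->
  (forall i, `|norm2 (vec (x i)) ^+ 2 / ell ^+ 2 - 1| <= delta) ->
  (forall v, `|bil (offdiag_gram x) v v| <= delta / 2 * ell ^+ 2 * nsq v) ->
  forall lambda : 'cV[R]_N,
    (1 - 2 * delta) * ell * norm2 lambda <= norm2 (comb x (fun i => lambda i 0)) /\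
    norm2 (comb x (fun i => lambda i 0)) <= (1 + 2 * delta) * ell * norm2 lambda.
Proof.
move=> l0 d0 d1 xn Hb lambda.
set v := fun i => lambda i 0; have := Hb v.
have nE : nsq v = norm2 lambda ^+ 2 by rewrite norm2_sqr.
have l2 : 0 < ell ^+ 2 by rewrite exprn_gt0.
have n0 : 0 <= norm2 lambda by exact: norm2_ge0.
have xi i : (1 - delta) * ell ^+ 2 <= norm2 (vec (x i)) ^+ 2 <= (1 + delta) * ell ^+ 2.
  have := xn i; rewrite ler_norml => /andP[a1 a2].
  by apply/andP; split; [rewrite -ler_pdivlMr|rewrite -ler_pdivrMr]; rewrite //; lra.
have S1 : (1 - delta) * ell ^+ 2 * nsq v <= \sum_i v i ^+ 2 * norm2 (vec (x i)) ^+ 2.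
  rewrite /nsq mulr_sumr; apply: ler_sum => i _.
  have /andP[h1 _] := xi i.
  by rewrite [leLHS]mulrC; apply: ler_wpM2l h1; exact: sqr_ge0.
have S2 : \sum_i v i ^+ 2 * norm2 (vec (x i)) ^+ 2 <= (1 + delta) * ell ^+ 2 * nsq v.
  rewrite /nsq mulr_sumr; apply: ler_sum => i _.
  have /andP[_ h1] := xi i.
  by rewrite [leRHS]mulrC; apply: ler_wpM2l h1; exact: sqr_ge0.
have E := norm2_comb_sqr x v.
have q0 : 0 <= ell ^+ 2 * norm2 lambda ^+ 2 by rewrite mulr_ge0 ?sqr_ge0.
rewrite ler_norml nE => /andP[b1 b2]; rewrite nE in S1 S2.
split.
  rewrite -ler_sqr ?nnegrE ?norm2_ge0 ?mulr_ge0 ?(ltW l0)//; last by lra.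
  rewrite E !exprMn -mulrA.
  have : (1 - 2 * delta) ^+ 2 <= 1 - 3/2 * delta by rewrite expr2; nra.
  move=> /(ler_wpM2r q0) /le_trans; apply.
  move: b1 S1; rewrite -!mulrA; lra.
rewrite -ler_sqr ?nnegrE ?norm2_ge0 ?mulr_ge0 ?(ltW l0)//; last by lra.
rewrite E !exprMn -[leRHS]mulrA.
have : 1 + 3/2 * delta <= (1 + 2 * delta) ^+ 2 by rewrite expr2; nra.
move=> /(ler_wpM2r q0); apply: le_trans.
move: b2 S2; rewrite -!mulrA; lra.
Qed.

(** * The choice of the constants and the conclusion *)

Lemma marginal_tail (d : measure_display) (T : measurableType d) (R : realType)
  (P : probability T R) (p : nat) (X : {RV P >-> p.-tuple R}) (n : nat) (c : R) :
  square_integrable P X -> 0 < opnorm (second_moment_mx P X) -> (0 < n)%N -> 0 <= c ->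
  (forall v : 'cV[R]_p, ('N[P]_(n%:R%:E)[EFin \o marginal X v] <=
     c%:E * 'N[P]_(2%:E)[EFin \o marginal X v])%E) ->
  forall (y : 'cV[R]_p) (t : R), 0 < t ->
    (P (X @^-1` [set x | (t * Num.sqrt (opnorm (second_moment_mx P X)) * norm2 y <
       `|dotp (vec x) y|)%R]) <= ((c / t) ^+ n)%:E)%E.
Proof.
move=> X2 op0 n0 c0 hq y t t0.
set s := Num.sqrt _; have s0 : 0 < s by rewrite sqrtr_gt0.
have [y0|y0] := eqVneq (norm2 y) 0.
  rewrite (_ : _ @^-1` _ = set0) ?measure0 ?lee_fin.
    by rewrite exprn_ge0// divr_ge0// ltW.
  rewrite -subset0 => w /=; rewrite y0 mulr0 => H.
  by have := lt_le_trans H (dotp_le _ _); rewrite y0 mulr0 ltxx.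
have yp : 0 < norm2 y by rewrite lt_neqAle eq_sym y0 norm2_ge0.
have a0 : 0 <= c * (s * norm2 y) by rewrite !mulr_ge0 ?norm2_ge0// ltW.
have b0 : 0 < t * s * norm2 y by rewrite !mulr_gt0.
have H := tail_of_Lnorm n0 (measurable_marginal X y) a0 b0.
have -> : c / t = c * (s * norm2 y) / (t * s * norm2 y) by field; rewrite !gt_eqF.
apply: H; apply: le_trans (hq y) _; rewrite EFinM.
apply: lee_wpmul2l; first by rewrite lee_fin.
exact: Lnorm2_marginal.
Qed.

(** Provides the finest scale: rounding all [N] entries at [2^-S] costs at most [N * 4^-S <= 1],
    while [4^S] stays of order [N]. *)
Lemma pow4_between (N : nat) : (0 < N)%N ->
  exists S, [/\ (0 < S)%N, (N <= 4 ^ S)%N & (4 ^ S <= 4 * N)%N].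
Proof.
elim: N => // N IH _; case: N IH => [|N] IH; first by exists 1%N.
have [S [S0 NS SN]] := IH isT.
have [lt|ge] := ltnP N.+1 (4 ^ S).
  by exists S; split=> //; apply: leq_trans SN _; rewrite leq_mul2l leqnSn.
have E : (4 ^ S)%N = N.+1 by apply/eqP; rewrite eqn_leq ge NS.
by exists S.+1; split=> //; rewrite expnS E; lia.
Qed.

Unset Implicit Arguments.
Unset Strict Implicit.
Unset Printing Implicit Defensive.

Theorem theorem13 (R : realType) (L alpha : R) (hL : 0 < L)
    (halpha : 0 < alpha) :
  exists c0 : R, 0 < c0 /\
  forall (delta Rq : R), 0 < delta -> delta < 1 / 2 -> 0 < Rq ->
  exists kappaDM : R, 0 < kappaDM /\
  forall (gamma : R) (p N : nat)
    (d0 : measure_display) (T0 : measurableType d0) (P0 : probability T0 R)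
    (X : {RV P0 >-> p.-tuple R})
    (d : measure_display) (T : measurableType d) (P : probability T R)
    (Xs : 'I_N -> {RV P >-> p.-tuple R})
    (dg : measure_display) (Tg : measurableType dg) (Pg : probability Tg R)
    (g : {RV Pg >-> p.-tuple R}),
  gamma < 1 -> (0 < N)%N ->
  iid_copies P P0 X Xs ->
  square_integrable P0 X -> centered P0 X -> symmetric_rv P0 X ->
  norm_concentration P0 X P Xs delta gamma ->
  moment_growth N P0 X Rq L alpha ->
  standard_gaussian Pg g ->
  N%:R <= kappaDM * dvoretzky_dim Pg g (second_moment_mx P0 X) ->
  ((1 - gamma - N%:R `^ (- c0))%:E <=
   P [set w | forall lambda : 'cV[R]_N,
       ((1 - 2 * delta) * lstar P0 X * norm2 lambda
          <= norm2 (random_matrix Xs w *m lambda))%R /\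
       (norm2 (random_matrix Xs w *m lambda)
          <= (1 + 2 * delta) * lstar P0 X * norm2 lambda)%R])%E.
Proof.
exists 1; split=> // delta Rq dl0 dl1 Rq0.
(* The integer [k] is the parameter [d] of the peeling, large enough for the contribution of the bad
   rows to be at most [delta/8 * B]. *)
have [k [k0 kb]] : exists k : nat, (0 < k)%N /\ 8 * (16 * 16) / delta < k%:R :> R.
  have b0 : 0 <= 8 * (16 * 16) / delta by rewrite !mulr_ge0// invr_ge0 ltW.
  have := archi_boundP b0; set m := Num.bound _ => mb.
  by exists m.+1; split=> //; apply: lt_trans mb _; rewrite ltr_nat.
have kr : 0 < k%:R :> R by rewrite ltr0n.
have kd : 16 * 16 / k%:R <= delta / 8.
  by rewrite ler_pdivrMr//; move: kb; rewrite ltr_pdivrMr//; lra.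
have [n nE] : exists n, n = (4 * (2 * k ^ 2 + 2))%N by exists (4 * (2 * k ^ 2 + 2))%N.
pose Cq : R := L * n%:R `^ alpha^-1.
have n2 : (2 <= n)%N by rewrite nE; lia.
have n0 : (0 < n)%N by exact: ltnW.
have Cq0 : 0 < Cq by rewrite mulr_gt0// powR_gt0// ltr0n.
pose C1 : R := 4 * expR 15 * Cq.
have C10 : 0 < C1 by rewrite mulr_gt0// mulr_gt0// expR_gt0.
pose D : R := 60 * (8 * 8) * C1 * Num.sqrt k%:R.
have D0 : 0 < D by rewrite mulr_gt0 ?sqrtr_gt0// mulr_gt0// !mulr_gt0.
(* If [n > Rq * ln (e * N)], the moment of order [n] is out of reach of (H2), but then [N <= N0]. *)
pose N0 : R := expR (n%:R / Rq).
have N00 : 0 < N0 by exact: expR_gt0.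
(* [k1] makes the good rows contribute at most [delta/8 * B] for large [N]; [k2] makes every
   off-diagonal entry small when [N <= N0]. *)
pose k1 : R := (delta / (8 * D)) ^+ 2.
pose k2 : R := delta ^+ 2 / (6 * N0 ^+ 4).
have k10 : 0 < k1 by rewrite exprn_gt0// divr_gt0// mulr_gt0.
have k20 : 0 < k2 by rewrite divr_gt0 ?exprn_gt0// mulr_gt0// exprn_gt0.
have dD : 0 <= delta / (8 * D) by rewrite ltW// divr_gt0// mulr_gt0.
have eqD : D * (delta / (8 * D)) = delta / 8.
  have field_id (a b : R) : 0 < b -> b * (a / (8 * b)) = a / 8.
    by move=> b0; field; rewrite gt_eqF.
  exact: field_id.
have eqN : 6 * k2 * N0 ^+ 4 = delta ^+ 2.
  have field_id (a b : R) : 0 < b -> 6 * (a / (6 * b)) * b = a.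
    by move=> b0; field; rewrite gt_eqF.
  by apply: field_id; rewrite exprn_gt0.
pose kap : R := Num.min k1 k2.
have kap0 : 0 < kap by rewrite lt_min k10.
have nv0 := normal_var_ge0 R.
exists (kap / (1 + normal_var R)); split; first by rewrite divr_gt0// ltr_pwDl.
move=> gamma p N d0 T0 P0 X d T P Xs dg Tg Pg g g1 Ngt0 [indX lawX] X2 _ _ H1 Hm gauss NK.
have Nr : 0 < N%:R :> R by rewrite ltr0n.
set G := second_moment_mx P0 X in NK.
set ell := lstar P0 X.
(* Since [N >= 1], the bound on [N] forces the dimension to be positive, which rules out a zero
   operator norm and the default square root. *)
have dd0 : 0 < dvoretzky_dim Pg g G.
  have := lt_le_trans Nr NK; rewrite pmulr_rgt0// divr_gt0// ltr_pwDl//.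
have [op0 dle] := dvoretzky_dim_le gauss dd0.
pose sigma := Num.sqrt (opnorm G).
have s0 : 0 < sigma by rewrite sqrtr_gt0.
have ellE : ell ^+ 2 = \tr G by exact: lstar_sqr.
have Ns : N%:R * sigma ^+ 2 <= kap * ell ^+ 2.
  rewrite sqr_sqrtr ?(ltW op0)// ellE.
  have trG : 0 <= \tr G by rewrite -ellE sqr_ge0.
  have q1 : 0 < 1 + normal_var R by rewrite ltr_pwDl.
  apply: (@le_trans _ _ (kap / (1 + normal_var R) * (normal_var R * \tr G))).
    apply: le_trans (ler_wpM2r (ltW op0) NK) _; rewrite -[leLHS]mulrA.
    by apply: ler_wpM2l dle; rewrite divr_ge0 ?(ltW kap0) ?(ltW q1).
  rewrite -mulrA ler_wpM2l ?(ltW kap0)// mulrA ler_piMl//.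
  by rewrite mulrC ler_pdivrMr// mul1r lerDr.
have l2 : 0 < ell ^+ 2.
  have : 0 < kap * ell ^+ 2.
    by apply: lt_le_trans Ns; rewrite mulr_gt0// exprn_gt0.
  by rewrite pmulr_rgt0.
have l0 : 0 < ell.
  by rewrite lt_neqAle sqrtr_ge0 andbT eq_sym; apply: contraTneq l2 => ->; rewrite expr0n ltxx.
pose xs (w : T) : 'I_N -> p.-tuple R := fun i => Xs i w.
have tailX m c i : (0 < m)%N -> 0 <= c ->
  (forall v : 'cV[R]_p, ('N[P0]_(m%:R%:E)[EFin \o marginal X v] <=
     c%:E * 'N[P0]_(2%:E)[EFin \o marginal X v])%E) ->
  forall y t, 0 < t -> (P (Xs i @^-1`
     [set x | (t * sigma * norm2 y < `|dotp (vec x) y|)%R]) <= ((c / t) ^+ m)%:E)%E.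
  move=> m0 c0 Hc y t t0; rewrite lawX; first exact: marginal_tail.
  apply: measurable_ltr_set; first exact: measurable_cst.
  apply: measurableT_comp => //; apply: measurable_dotp; last first.
    by move=> j; exact: measurable_cst.
  exact: (mvec_vec (f := id)).
have [Bad [mBad PBad HBad]] : exists Bad : set T,
  [/\ measurable Bad, (P Bad <= (N%:R^-1)%:E)%E & forall w, ~ Bad w ->
    (forall i, norm2 (vec (xs w i)) ^+ 2 <= 3/2 * ell ^+ 2) ->
    forall v, `|bil (offdiag_gram (xs w)) v v| <= delta / 2 * ell ^+ 2 * nsq v].
  have [qR|qR] := leP n%:R (Rq * ln (expR 1 * N%:R)).
    have [S [S0 NS SN]] := pow4_between Ngt0.
    have [|Bad [mBad PBad HBad]] := @large_event _ _ _ P p N Xs indX Ngt0 sigma S (k ^ 2) Cq SN Cq0.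
      rewrite -nE => i y t t0; apply: tailX => //; first exact: ltW.
      by move=> v; apply: Hm qR; rewrite ler_nat.
    exists Bad; split=> // w nB xle.
    apply: (large_offdiag xle (sigma := sigma) (kappa := kap) (C := C1) (d := k) Ngt0 S0 NS SN) => //.
    - exact: ltW.
    - exact: ltW.
    - exact: ltW.
    - exact: ltW.
    - rewrite -/D; apply: (@le_trans _ _ (D * (delta / (8 * D)))).
        rewrite ler_wpM2l ?(ltW D0)//.
        rewrite -[leRHS](ger0_norm dD).
        by rewrite -sqrtr_sqr ler_wsqrtr// ge_min lexx.
      by rewrite eqD.
    - exact: HBad.
  have [|Bad [mBad PBad HBad]] := @small_event _ _ _ P p N Xs indX Ngt0 sigma.
    move=> i y t t0; apply: (tailX 2%N) => // v; by rewrite mul1e.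
  exists Bad; split=> // w nB xle.
  apply: (small_offdiag xle (sigma := sigma) (kappa := kap) Ngt0) => //.
  - exact: ltW.
  - exact: ltW.
  - have NN0 : N%:R <= N0.
      rewrite -[leLHS](@lnK R) ?posrE// ler_expR ler_pdivlMr//.
      move: qR; rewrite lnM ?posrE ?expR_gt0// expRK mulrDr mulr1 => qR.
      by rewrite mulrC; apply/ltW; apply: le_lt_trans qR; rewrite lerDr ltW.
    apply: (@le_trans _ _ (6 * k2 * N0 ^+ 4)).
      apply: ler_pM; rewrite ?mulr_ge0 ?exprn_ge0 ?(ltW kap0)//.
        by rewrite ler_wpM2l// ge_min lexx orbT.
      by rewrite lerXn2r ?nnegrE// ltW.
    by rewrite eqN.
  - exact: HBad.
pose Conc := [set w | forall i : 'I_N, true ->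
   `|norm2 (vec (Xs i w)) ^+ 2 / ell ^+ 2 - 1| <= delta].
have mConc : measurable Conc.
  apply: (measurable_finI (Q := fun=> true)) => i _.
  apply: measurable_ler_set; last exact: measurable_cst.
  apply: measurableT_comp => //; apply: measurable_funB => //.
  apply: measurable_funM => //; apply: measurable_funX; apply: measurable_norm2.
  exact: (mvec_vec (f := Xs i)).
have ConcE : [set w | \big[Num.max/0]_(i < N)
      `|norm2 (vec (Xs i w)) ^+ 2 / lstar P0 X ^+ 2 - 1| <= delta] = Conc.
  apply/seteqP; split=> w /=.
    by move=> H i _; apply: le_trans H; exact: le_bigmax.
  by move=> H; apply: bigmax_le; [exact: ltW|move=> i _; exact: H].
have PConc : ((1 - gamma)%:E <= P Conc)%E by rewrite -ConcE.
set target := [set w | _].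
have mtarget : measurable target.
  by apply: (measurable_isometry_event Xs); rewrite mulr_ge0 ?(ltW l0)//; lra.
have sub : Conc `\` Bad `<=` target.
  move=> w [Cw nB] lambda.
  have Cw' i : `|norm2 (vec (xs w i)) ^+ 2 / ell ^+ 2 - 1| <= delta by exact: Cw.
  have xle i : norm2 (vec (xs w i)) ^+ 2 <= 3/2 * ell ^+ 2.
    have := Cw' i; rewrite ler_norml => /andP[_ a2].
    by rewrite -ler_pdivrMr//; lra.
  have := near_isometry l0 dl0 dl1 Cw' (HBad w nB xle) lambda.
  have -> // : comb (xs w) (fun i => lambda i 0) = random_matrix Xs w *m lambda.
  apply/matrixP => i j; rewrite ord1 /comb summxE mxE; apply: eq_bigr => l _.
  by rewrite !mxE mulrC.
have PC : (P Conc <= P target + (N%:R^-1)%:E)%E.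
  (* The concentration event is covered by the target and [Bad], which has probability at most
     [N^-1]; hence [c0 = 1]. *)
  apply: (@le_trans _ _ (P (target `|` Bad))).
    apply: le_measure; rewrite ?inE//; first exact: measurableU.
    by move=> w Cw; have [Bw|nBw] := pselect (Bad w); [right|left; apply: sub].
  apply: le_trans (measureU2 _ mtarget mBad) _; exact: leeD2l.
rewrite powRN powRr1 ?ler0n// EFinB leeBlDr//.
exact: le_trans PConc PC.
Qed.
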